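(* Let $K$ be a field of characteristic $p>0$, and $S=K[x_1,\ldots,x_n]$. Let $f\in S$ be a square-free supported polynomial with irreducible factors $f_1,\ldots,f_t$. If $Q=(f_1,\ldots,f_t)$, then $R=S/Q$ is geometrically F-rational.
   Context: A polynomial $f\in S=K[x_1,\ldots,x_n]$ is square-free supported if every monomial appearing in $f$ with non-zero coefficient is square-free (equivalently, $f$ has degree at most one in each variable). Saying that $f$ has irreducible factors $f_1,\ldots,f_t$ means $f=f_1\cdots f_t$ with every $f_i$ irreducible in $S$. A Noetherian ring $R$ of prime characteristic $p$ is F-rational if every parameter ideal of $R$ is tightly closed. An ideal $I=(r_1,\ldots,r_m)$ of $R$ is a parameter ideal if for every prime ideal $\mathfrak p\supseteq I$ the images of $r_1,\ldots,r_m$ in $R_{\mathfrak p}$ form part of a system of parameters of $R_{\mathfrak p}$. An ideal $I$ is tightly closed if $I=I^*$, where $I^*$ is the set of $r\in R$ for which there is $c\in R$ not in any minimal prime of $R$ with $cr^{p^e}\in I^{[p^e]}$ for all $e\gg 0$; here $I^{[p^e]}$ is the ideal generated by the $p^e$-th powers of elements of $I$. For $R=K[x_1,\ldots,x_n]/I$, $R$ is geometrically F-rational if $R\otimes_K L$ is F-rational for every field extension $L$ of $K$. *)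

(* Defs.v *)
From HB Require Import structures.
From mathcomp Require Import all_boot all_order all_algebra.
From mathcomp Require Import generic_quotient ring_quotient.
From mathcomp Require Import boolp classical_sets.
From mathcomp Require Import ring mpoly.

Set Implicit Arguments.
Unset Strict Implicit.
Unset Printing Implicit Defensive.

Import GRing.Theory.
Local Open Scope classical_set_scope.
Local Open Scope ring_scope.
Local Open Scope quotient_scope.

Section Ideals.
Variable A : comPzRingType.
Implicit Types (I P : set A) (X : set A).

Definition is_ideal I :=
  [/\ I 0, forall a b, I a -> I b -> I (a + b) & forall a b, I b -> I (a * b)].

Definition is_prime P :=
  [/\ is_ideal P, ~ P 1 & forall a b, P (a * b) -> P a \/ P b].

Definition ideal_gen X : set A := smallest is_ideal X.

Definition minimal_prime P :=
  is_prime P /\ forall P', is_prime P' -> P' `<=` P -> P' = P.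

Definition noetherian :=
  forall I, is_ideal I -> exists r : seq A, I = ideal_gen [set` r].

Lemma ideal_gen_ideal X : is_ideal (ideal_gen X).
Proof.
split=> [I [[]]//|a b Ia Ib I [II XI]|a b Ib I [II XI]]; case: (II) => _ ID IM.
  by apply: ID; [apply: Ia|apply: Ib].
by apply: IM; apply: Ib.
Qed.

Lemma sub_ideal_gen X : X `<=` ideal_gen X.
Proof. by move=> x Xx I [_]; apply. Qed.

Lemma ideal_gen_min X I : is_ideal I -> X `<=` I -> ideal_gen X `<=` I.
Proof. by move=> II XI x; apply. Qed.

End Ideals.

Record prime_ideal (A : comPzRingType) := PrimeIdeal {
  prime_set : set A;
  prime_setP : is_prime prime_set }.

Section RingQuot.
Variable A : comPzRingType.

Definition in_ideal_gen (X : set A) : {pred A} := fun a => `[< ideal_gen X a >].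

Section ClosedInstance.
Variable X : set A.

Fact in_ideal_gen_zmod_closed : zmod_closed (in_ideal_gen X).
Proof.
have [I0 ID IM] := ideal_gen_ideal X.
split=> [|a b /asboolP Ia /asboolP Ib]; apply/asboolP => //.
by apply: ID => //; rewrite -mulN1r; apply: IM.
Qed.

HB.instance Definition _ := GRing.isZmodClosed.Build A (in_ideal_gen X)
  in_ideal_gen_zmod_closed.
End ClosedInstance.

(* The quotient of A by the ideal generated by X. [{ideal_quot _}] has a ring
   structure only for proper ideals; here the zero ring is allowed. *)
Definition ring_quot (X : set A) : Type :=
  {ideal_quot (GRing.ZmodClosed.clone A (in_ideal_gen X) _)}.

Variable X : set A.
Notation Q := (ring_quot X).

HB.instance Definition _ := ZmodQuotient.on Q.

Definition ring_quot_pi (a : A) : Q := \pi a.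

Lemma ring_quot_eqP a b :
  ring_quot_pi a = ring_quot_pi b <-> ideal_gen X (a - b).
Proof.
rewrite /ring_quot_pi; split=> [/eqP|h].
  by rewrite piE => /asboolP.
by apply/eqP; rewrite piE; apply/asboolP.
Qed.

Definition ring_quot_one : Q := ring_quot_pi 1.
Definition ring_quot_mul (x y : Q) : Q := ring_quot_pi (repr x * repr y).

Lemma ring_quot_piM a b :
  ring_quot_mul (ring_quot_pi a) (ring_quot_pi b) = ring_quot_pi (a * b).
Proof.
have [_ ID IM] := ideal_gen_ideal X.
have rp c : ideal_gen X (repr (ring_quot_pi c) - c).
  by apply/ring_quot_eqP; rewrite /ring_quot_pi reprK.
apply/ring_quot_eqP.
set a' := repr _; set b' := repr _.
have -> : a' * b' - a * b = b' * (a' - a) + a * (b' - b).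
  by rewrite !mulrBr [b' * a']mulrC [b' * a]mulrC addrA subrK.
by apply: ID; apply: IM; apply: rp.
Qed.

Lemma ring_quot_ind (S : Q -> Prop) :
  (forall a, S (ring_quot_pi a)) -> forall x, S x.
Proof. by move=> Sp x; rewrite -[x]reprK; apply: Sp. Qed.

Lemma ring_quot_piD a b :
  ring_quot_pi a + ring_quot_pi b = ring_quot_pi (a + b).
Proof. by rewrite /ring_quot_pi !piE. Qed.

Fact ring_quot_mulA : associative ring_quot_mul.
Proof.
elim/ring_quot_ind=> a; elim/ring_quot_ind=> b; elim/ring_quot_ind=> c.
by rewrite !ring_quot_piM mulrA.
Qed.

Fact ring_quot_mulC : commutative ring_quot_mul.
Proof.
by elim/ring_quot_ind=> a; elim/ring_quot_ind=> b; rewrite !ring_quot_piM mulrC.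
Qed.

Fact ring_quot_mul1 : left_id ring_quot_one ring_quot_mul.
Proof. by elim/ring_quot_ind=> a; rewrite ring_quot_piM mul1r. Qed.

Fact ring_quot_mulDl : left_distributive ring_quot_mul +%R.
Proof.
elim/ring_quot_ind=> a; elim/ring_quot_ind=> b; elim/ring_quot_ind=> c.
by rewrite !(ring_quot_piD, ring_quot_piM) mulrDl.
Qed.

HB.instance Definition _ := GRing.Zmodule_isComPzRing.Build Q
  ring_quot_mulA ring_quot_mulC ring_quot_mul1 ring_quot_mulDl.

Fact ring_quot_pi_is_zmod_morphism : zmod_morphism ring_quot_pi.
Proof. exact: (raddfB \pi_Q). Qed.

Fact ring_quot_pi_is_monoid_morphism : monoid_morphism ring_quot_pi.
Proof. by split=> // a b; rewrite -ring_quot_piM. Qed.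

HB.instance Definition _ :=
  GRing.isZmodMorphism.Build A Q ring_quot_pi ring_quot_pi_is_zmod_morphism.
HB.instance Definition _ :=
  GRing.isMonoidMorphism.Build A Q ring_quot_pi ring_quot_pi_is_monoid_morphism.

End RingQuot.

Section Localization.
Variables (A : comPzRingType) (P : prime_ideal A).

Lemma prime_not1 : ~ prime_set P 1.
Proof. by case: (prime_setP P). Qed.

Lemma prime_mulN s t : ~ prime_set P s -> ~ prime_set P t -> ~ prime_set P (s * t).
Proof. by have [_ _ PM] := prime_setP P => Ps Pt /PM []. Qed.

Definition denominator := {s : A | s \notin prime_set P}.

Definition frac : Type := A * denominator.

HB.instance Definition _ := Choice.on frac.

Definition num (x : frac) : A := x.1.
Definition den (x : frac) : A := val x.2.

Lemma denP x : ~ prime_set P (den x).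
Proof. by case: x => a [s Ps] /mem_set; apply/negP. Qed.

Definition mk_den (s : A) (Ps : ~ prime_set P s) : denominator :=
  exist _ s (introN idP (fun Ps' => Ps (set_mem Ps'))).

Definition mk_frac (a s : A) (Ps : ~ prime_set P s) : frac := (a, mk_den Ps).

Definition frac_eq (x y : frac) : bool :=
  `[< exists2 u, ~ prime_set P u & u * (num x * den y) = u * (num y * den x) >].

Fact frac_eq_equiv : equiv_class_of frac_eq.
Proof.
split=> [x|x y|y x z].
- by apply/asboolP; exists 1 => //; apply: prime_not1.
- by apply/asboolP/asboolP => -[u Pu e]; exists u.
- move=> /asboolP[u Pu e] /asboolP[v Pv e']; apply/asboolP.
  exists (u * v * den y); first by do 2?apply: prime_mulN => //; apply: denP.
  transitivity (v * den z * (u * (num x * den y))); first by ring.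
  transitivity (u * den x * (v * (num y * den z))); first by rewrite e; ring.
  by rewrite e'; ring.
Qed.

Canonical frac_eq_equivRel := EquivRelPack frac_eq_equiv.
Canonical frac_eq_encModRel := defaultEncModRel frac_eq.

Definition loc : Type := {eq_quot frac_eq}.

HB.instance Definition _ : EqQuotient frac frac_eq loc := EqQuotient.on loc.
HB.instance Definition _ := Choice.on loc.

Definition loc_frac (a s : A) (Ps : ~ prime_set P s) : loc :=
  \pi_loc (mk_frac a Ps).

Lemma loc_eqP (x y : frac) : \pi_loc x = \pi_loc y <->
  exists2 u, ~ prime_set P u & u * (num x * den y) = u * (num y * den x).
Proof.
split=> [/eqP|h]; first by rewrite piE => /asboolP.
by apply/eqP; rewrite piE; apply/asboolP.
Qed.

Lemma loc_fracP a s (Ps : ~ prime_set P s) b t (Pt : ~ prime_set P t) :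
  loc_frac a Ps = loc_frac b Pt <->
  exists2 u, ~ prime_set P u & u * (a * t) = u * (b * s).
Proof. exact: loc_eqP. Qed.

Lemma loc_ind (S : loc -> Prop) :
  (forall a s Ps, S (@loc_frac a s Ps)) -> forall x, S x.
Proof.
move=> Sf x; rewrite -[x]reprK; case: (repr x) => a [s Ps].
have Ps' : ~ prime_set P s by move=> /mem_set; apply/negP.
suff -> : (a, exist _ s Ps) = mk_frac a Ps' by apply: Sf.
by congr pair; apply: val_inj.
Qed.

Definition loc_zero : loc := loc_frac 0 prime_not1.
Definition loc_one : loc := loc_frac 1 prime_not1.
Definition loc_opp (x : loc) : loc := loc_frac (- num (repr x)) (@denP (repr x)).
Definition loc_add (x y : loc) : loc :=
  let: (f, g) := (repr x, repr y) in
  loc_frac (num f * den g + num g * den f) (prime_mulN (@denP f) (@denP g)).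
Definition loc_mul (x y : loc) : loc :=
  let: (f, g) := (repr x, repr y) in
  loc_frac (num f * num g) (prime_mulN (@denP f) (@denP g)).

Let repr_frac a s (Ps : ~ prime_set P s) :
  exists2 u, ~ prime_set P u &
    u * (num (repr (loc_frac a Ps)) * s) = u * (a * den (repr (loc_frac a Ps))).
Proof. by apply/(loc_eqP _ (mk_frac a Ps)); rewrite reprK. Qed.

Lemma loc_oppE a s (Ps : ~ prime_set P s) :
  loc_opp (loc_frac a Ps) = loc_frac (- a) Ps.
Proof.
apply/loc_fracP; have [u Pu e] := repr_frac a Ps; exists u => //.
by rewrite !mulNr !mulrN e.
Qed.

Lemma loc_addE a s (Ps : ~ prime_set P s) b t (Pt : ~ prime_set P t) :
  loc_add (loc_frac a Ps) (loc_frac b Pt)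
  = loc_frac (a * t + b * s) (prime_mulN Ps Pt).
Proof.
have [u Pu e] := repr_frac a Ps; have [v Pv e'] := repr_frac b Pt.
rewrite /loc_add; set f := repr _ in e *; set g := repr _ in e' *.
apply/loc_fracP; exists (u * v); first exact: prime_mulN.
transitivity (u * (num f * s) * (v * den g * t)
              + v * (num g * t) * (u * den f * s)); first by ring.
by rewrite e e'; ring.
Qed.

Lemma loc_mulE a s (Ps : ~ prime_set P s) b t (Pt : ~ prime_set P t) :
  loc_mul (loc_frac a Ps) (loc_frac b Pt) = loc_frac (a * b) (prime_mulN Ps Pt).
Proof.
have [u Pu e] := repr_frac a Ps; have [v Pv e'] := repr_frac b Pt.
rewrite /loc_mul; set f := repr _ in e *; set g := repr _ in e' *.
apply/loc_fracP; exists (u * v); first exact: prime_mulN.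
transitivity (u * (num f * s) * (v * (num g * t))); first by ring.
by rewrite e e'; ring.
Qed.

Let loc_eq a s (Ps : ~ prime_set P s) b t (Pt : ~ prime_set P t) :
  a * t = b * s -> loc_frac a Ps = loc_frac b Pt.
Proof.
by move=> e; apply/loc_fracP; exists 1; [apply: prime_not1|rewrite e].
Qed.

Fact loc_addA : associative loc_add.
Proof.
elim/loc_ind=> a s Ps; elim/loc_ind=> b t Pt; elim/loc_ind=> c u Pu.
by rewrite !loc_addE; apply: loc_eq; ring.
Qed.

Fact loc_addC : commutative loc_add.
Proof.
elim/loc_ind=> a s Ps; elim/loc_ind=> b t Pt.
by rewrite !loc_addE; apply: loc_eq; ring.
Qed.

Fact loc_add0 : left_id loc_zero loc_add.
Proof. by elim/loc_ind=> a s Ps; rewrite !loc_addE; apply: loc_eq; ring. Qed.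

Fact loc_addN : left_inverse loc_zero loc_opp loc_add.
Proof.
elim/loc_ind=> a s Ps.
by rewrite loc_oppE loc_addE; apply: loc_eq; ring.
Qed.

HB.instance Definition _ := GRing.isZmodule.Build loc
  loc_addA loc_addC loc_add0 loc_addN.

Fact loc_mulA : associative loc_mul.
Proof.
elim/loc_ind=> a s Ps; elim/loc_ind=> b t Pt; elim/loc_ind=> c u Pu.
by rewrite !loc_mulE; apply: loc_eq; ring.
Qed.

Fact loc_mulC : commutative loc_mul.
Proof.
elim/loc_ind=> a s Ps; elim/loc_ind=> b t Pt.
by rewrite !loc_mulE; apply: loc_eq; ring.
Qed.

Fact loc_mul1 : left_id loc_one loc_mul.
Proof. by elim/loc_ind=> a s Ps; rewrite !loc_mulE; apply: loc_eq; ring. Qed.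

Fact loc_mulDl : left_distributive loc_mul loc_add.
Proof.
elim/loc_ind=> a s Ps; elim/loc_ind=> b t Pt; elim/loc_ind=> c u Pu.
by rewrite !(loc_addE, loc_mulE); apply: loc_eq; ring.
Qed.

HB.instance Definition _ := GRing.Zmodule_isComPzRing.Build loc
  loc_mulA loc_mulC loc_mul1 loc_mulDl.

Definition to_loc (a : A) : loc := loc_frac a prime_not1.

Fact to_loc_is_zmod_morphism : zmod_morphism to_loc.
Proof.
move=> a b; rewrite [RHS]/GRing.add /= [X in loc_add _ X]/GRing.opp /=.
by rewrite loc_oppE loc_addE; apply: loc_eq; ring.
Qed.

Fact to_loc_is_monoid_morphism : monoid_morphism to_loc.
Proof.
split=> // a b; rewrite [RHS]/GRing.mul /= loc_mulE.
by apply: loc_eq; ring.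
Qed.

HB.instance Definition _ :=
  GRing.isZmodMorphism.Build A loc to_loc to_loc_is_zmod_morphism.
HB.instance Definition _ :=
  GRing.isMonoidMorphism.Build A loc to_loc to_loc_is_monoid_morphism.

End Localization.

Section Tensor.
Variables (K A B : comPzRingType).
Variables (phi : {rmorphism K -> A}) (psi : {rmorphism K -> B}).

Definition biadditive (M : zmodType) (b : A -> B -> M) :=
  (forall y, {morph b^~ y : x x' / x + x'}) /\
  (forall x, {morph b x : y y' / y + y'}).

Definition balanced (M : zmodType) (b : A -> B -> M) :=
  forall k x y, b (phi k * x) y = b x (psi k * y).

(* [:: (x1, y1); ...; (xn, yn)] stands for the sum of the pure tensors
   xi (x) yi. Two such sums are equal in the tensor product over K if and only
   if no K-balanced biadditive map separates them. *)
Definition tsum : Type := seq (A * B).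

HB.instance Definition _ := Choice.on tsum.

Definition tsum_eval (M : zmodType) (b : A -> B -> M) (s : tsum) : M :=
  \sum_(z <- s) b z.1 z.2.

Definition tsum_eq (s t : tsum) : bool :=
  `[< forall (M : zmodType) (b : A -> B -> M),
        biadditive b -> balanced b -> tsum_eval b s = tsum_eval b t >].

Fact tsum_eq_equiv : equiv_class_of tsum_eq.
Proof.
split=> [s|s t|t s u]; first exact/asboolP.
  by apply/asboolP/asboolP => e M b bb bal; rewrite e.
by move=> /asboolP e /asboolP e'; apply/asboolP => M b bb bal; rewrite e // e'.
Qed.

Canonical tsum_eq_equivRel := EquivRelPack tsum_eq_equiv.
Canonical tsum_eq_encModRel := defaultEncModRel tsum_eq.

Definition tensor : Type := {eq_quot tsum_eq}.

HB.instance Definition _ : EqQuotient tsum tsum_eq tensor :=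
  EqQuotient.on tensor.
HB.instance Definition _ := Choice.on tensor.

Lemma tensor_eqP (s t : tsum) : \pi_tensor s = \pi_tensor t <->
  forall (M : zmodType) (b : A -> B -> M),
    biadditive b -> balanced b -> tsum_eval b s = tsum_eval b t.
Proof.
split=> [/eqP|h]; first by rewrite piE => /asboolP.
by apply/eqP; rewrite piE; apply/asboolP.
Qed.

Let repr_eval (s : tsum) (M : zmodType) (b : A -> B -> M) :
  biadditive b -> balanced b ->
  tsum_eval b (repr (\pi_tensor s)) = tsum_eval b s.
Proof. by move: M b; apply/tensor_eqP; rewrite reprK. Qed.

Definition tensor_zero : tensor := \pi_tensor [::].
Definition tensor_opp (x : tensor) : tensor :=
  \pi_tensor [seq (- z.1, z.2) | z <- repr x].
Definition tensor_add (x y : tensor) : tensor := \pi_tensor (repr x ++ repr y).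
Definition tensor_one : tensor := \pi_tensor [:: (1, 1)].
Definition tensor_mul (x y : tensor) : tensor :=
  \pi_tensor [seq (z.1 * w.1, z.2 * w.2) | z <- repr x, w <- repr y].

Let eval_cat (M : zmodType) (b : A -> B -> M) (s t : tsum) :
  tsum_eval b (s ++ t) = tsum_eval b s + tsum_eval b t.
Proof. by rewrite /tsum_eval big_cat. Qed.

Let eval_mul (M : zmodType) (b : A -> B -> M) (s t : tsum) :
  tsum_eval b [seq (z.1 * w.1, z.2 * w.2) | z <- s, w <- t] =
  \sum_(z <- s) \sum_(w <- t) b (z.1 * w.1) (z.2 * w.2).
Proof. by rewrite /tsum_eval big_allpairs_dep. Qed.

Let eval_opp (M : zmodType) (b : A -> B -> M) (s : tsum) : biadditive b ->
  tsum_eval b [seq (- z.1, z.2) | z <- s] = - tsum_eval b s.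
Proof.
move=> [bl _]; rewrite /tsum_eval big_map -sumrN; apply: eq_bigr => z _ /=.
have b0 : b 0 z.2 = 0 by apply: (addrI (b 0 z.2)); rewrite -bl !addr0.
by apply/eqP; rewrite -addr_eq0 -bl addNr b0.
Qed.

Lemma tensor_oppE (s : tsum) :
  tensor_opp (\pi s) = \pi_tensor [seq (- z.1, z.2) | z <- s].
Proof. by apply/tensor_eqP => M b bb bal; rewrite !eval_opp // repr_eval. Qed.

Lemma tensor_addE (s t : tsum) :
  tensor_add (\pi s) (\pi t) = \pi_tensor (s ++ t).
Proof. by apply/tensor_eqP => M b bb bal; rewrite !eval_cat // !repr_eval. Qed.

Lemma tensor_mulE (s t : tsum) :
  tensor_mul (\pi s) (\pi t) =
  \pi_tensor [seq (z.1 * w.1, z.2 * w.2) | z <- s, w <- t].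
Proof.
apply/tensor_eqP => M b [bl br] bal; rewrite !eval_mul.
under eq_bigr => z _.
  have := @repr_eval t M (fun x y => b (z.1 * x) (z.2 * y)).
  rewrite /tsum_eval /= => ->; last 2 first.
  - by split=> [y x x'|x y y']; rewrite mulrDr ?bl ?br.
  - by move=> k x y; rewrite mulrCA bal [psi k * _]mulrCA.
  over.
rewrite exchange_big [RHS]exchange_big /=; apply: eq_bigr => w _.
apply: (@repr_eval s M (fun x y => b (x * w.1) (y * w.2))).
- by split=> [y x x'|x y y']; rewrite mulrDl ?bl ?br.
- by move=> k x y; rewrite -mulrA bal mulrA.
Qed.

Lemma tensor_ind (S : tensor -> Prop) :
  (forall s : tsum, S (\pi s)) -> forall x, S x.
Proof. by move=> Sp x; rewrite -[x]reprK; apply: Sp. Qed.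

Fact tensor_addA : associative tensor_add.
Proof.
elim/tensor_ind=> s; elim/tensor_ind=> t; elim/tensor_ind=> u.
by rewrite !tensor_addE catA.
Qed.

Fact tensor_addC : commutative tensor_add.
Proof.
elim/tensor_ind=> s; elim/tensor_ind=> t; rewrite !tensor_addE.
by apply/tensor_eqP => M b _ _; rewrite !eval_cat addrC.
Qed.

Fact tensor_add0 : left_id tensor_zero tensor_add.
Proof. by elim/tensor_ind=> s; rewrite tensor_addE. Qed.

Fact tensor_addN : left_inverse tensor_zero tensor_opp tensor_add.
Proof.
elim/tensor_ind=> s; rewrite tensor_oppE tensor_addE.
apply/tensor_eqP => M b bb _.
by rewrite eval_cat eval_opp // addNr /tsum_eval big_nil.
Qed.

HB.instance Definition _ := GRing.isZmodule.Build tensor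
  tensor_addA tensor_addC tensor_add0 tensor_addN.

Fact tensor_mulA : associative tensor_mul.
Proof.
elim/tensor_ind=> s; elim/tensor_ind=> t; elim/tensor_ind=> u.
rewrite !tensor_mulE; apply/tensor_eqP => M b bb bal.
rewrite !eval_mul big_allpairs_dep /=; apply: eq_bigr => z _.
rewrite big_allpairs_dep /=; apply: eq_bigr => w _; apply: eq_bigr => v _.
by rewrite !mulrA.
Qed.

Fact tensor_mulC : commutative tensor_mul.
Proof.
elim/tensor_ind=> s; elim/tensor_ind=> t.
rewrite !tensor_mulE; apply/tensor_eqP => M b bb bal.
rewrite !eval_mul exchange_big /=; apply: eq_bigr => z _; apply: eq_bigr => w _.
by rewrite mulrC [_.2 * _]mulrC.
Qed.

Fact tensor_mul1 : left_id tensor_one tensor_mul.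
Proof.
elim/tensor_ind=> s; rewrite tensor_mulE; apply/tensor_eqP => M b bb bal.
by rewrite eval_mul big_seq1 /=; apply: eq_bigr => z _; rewrite !mul1r.
Qed.

Fact tensor_mulDl : left_distributive tensor_mul tensor_add.
Proof.
elim/tensor_ind=> s; elim/tensor_ind=> t; elim/tensor_ind=> u.
rewrite !(tensor_addE, tensor_mulE); apply/tensor_eqP => M b bb bal.
by rewrite eval_cat !eval_mul big_cat.
Qed.

HB.instance Definition _ := GRing.Zmodule_isComPzRing.Build tensor
  tensor_mulA tensor_mulC tensor_mul1 tensor_mulDl.

Definition pure (x : A) (y : B) : tensor := \pi_tensor [:: (x, y)].
Definition tensorl (x : A) : tensor := pure x 1.
Definition tensorr (y : B) : tensor := pure 1 y.

Lemma pure_biadditive : biadditive pure.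
Proof.
split=> [y x x'|x y y']; rewrite [RHS]tensor_addE; apply/tensor_eqP;
  by move=> M b [bl br] _; rewrite /tsum_eval big_cat !big_seq1 /= ?bl ?br.
Qed.

Lemma pure_balanced : balanced pure.
Proof.
move=> k x y; apply/tensor_eqP => M b _ bal.
by rewrite /tsum_eval !big_seq1 /= bal.
Qed.

Lemma pureM x x' y y' : pure x y * pure x' y' = pure (x * x') (y * y').
Proof. by rewrite [LHS]tensor_mulE. Qed.

Fact tensorl_is_zmod_morphism : zmod_morphism tensorl.
Proof.
move=> x x'; apply/eqP; rewrite eq_sym subr_eq /tensorl.
by rewrite -pure_biadditive.1 subrK.
Qed.

Fact tensorl_is_monoid_morphism : monoid_morphism tensorl.
Proof. by split=> // x x'; rewrite /tensorl pureM mulr1. Qed.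

HB.instance Definition _ :=
  GRing.isZmodMorphism.Build A tensor tensorl tensorl_is_zmod_morphism.
HB.instance Definition _ :=
  GRing.isMonoidMorphism.Build A tensor tensorl tensorl_is_monoid_morphism.

Fact tensorr_is_zmod_morphism : zmod_morphism tensorr.
Proof.
move=> y y'; apply/eqP; rewrite eq_sym subr_eq /tensorr.
by rewrite -pure_biadditive.2 subrK.
Qed.

Fact tensorr_is_monoid_morphism : monoid_morphism tensorr.
Proof. by split=> // y y'; rewrite /tensorr pureM mulr1. Qed.

HB.instance Definition _ :=
  GRing.isZmodMorphism.Build B tensor tensorr tensorr_is_zmod_morphism.
HB.instance Definition _ :=
  GRing.isMonoidMorphism.Build B tensor tensorr tensorr_is_monoid_morphism.

Lemma tensorl_tensorr k : tensorl (phi k) = tensorr (psi k).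
Proof. by have := pure_balanced k 1 1; rewrite !mulr1. Qed.

Lemma tensor_univ (T : comPzRingType)
    (f : {rmorphism A -> T}) (g : {rmorphism B -> T}) :
  (forall k, f (phi k) = g (psi k)) ->
  exists h : {rmorphism tensor -> T},
    [/\ forall x, h (tensorl x) = f x, forall y, h (tensorr y) = g y &
      forall h' : {rmorphism tensor -> T}, (forall x, h' (tensorl x) = f x) ->
        (forall y, h' (tensorr y) = g y) -> h' =1 h].
Proof.
move=> fg; pose b x y := f x * g y.
have bb : biadditive b.
  by split=> [y x x'|x y y']; rewrite /b rmorphD ?mulrDl ?mulrDr.
have bal : balanced b.
  by move=> k x y; rewrite /b !rmorphM fg mulrA [g _ * f _]mulrC.
pose h (z : tensor) : T := tsum_eval b (repr z).
have hE s : h (\pi s) = tsum_eval b s by apply: repr_eval.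
have hD : {morph h : x y / x + y}.
  elim/tensor_ind=> s; elim/tensor_ind=> t.
  by rewrite [X in h X]tensor_addE !hE eval_cat.
have hB : zmod_morphism h.
  by move=> x y; apply/eqP; rewrite eq_sym subr_eq -hD subrK.
have hM : monoid_morphism h.
  split; first by rewrite hE /tsum_eval big_seq1 /b !rmorph1 mulr1.
  elim/tensor_ind=> s; elim/tensor_ind=> t.
  rewrite [X in h X]tensor_mulE !hE eval_mul /tsum_eval mulr_suml.
  apply: eq_bigr => z _; rewrite mulr_sumr; apply: eq_bigr => w _.
  by rewrite /b !rmorphM mulrACA.
pose hm := GRing.isMonoidMorphism.Build _ _ h hM.
pose hz := GRing.isZmodMorphism.Build _ _ h hB.
pose H : {rmorphism tensor -> T} := HB.pack h hz hm.
exists H; split=> [x|y|h' hl hr z].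
- by rewrite [LHS]hE /tsum_eval big_seq1 /b rmorph1 mulr1.
- by rewrite [LHS]hE /tsum_eval big_seq1 /b rmorph1 mul1r.
elim/tensor_ind: z => s; rewrite [RHS]hE.
elim: s => [|[x y] s IH]; first by rewrite /tsum_eval big_nil; apply: rmorph0.
have -> : \pi_tensor ((x, y) :: s) = pure x y + \pi s.
  by rewrite [RHS]tensor_addE.
rewrite rmorphD IH /tsum_eval big_cons; congr (_ + _).
by rewrite /b /= -hl -hr -rmorphM pureM mulr1 mul1r.
Qed.

End Tensor.

Section FRational.
Implicit Type A : comPzRingType.

Definition prime_chain A (d : nat) (c : nat -> set A) :=
  (forall i, (i <= d)%N -> is_prime (c i)) /\
  (forall i, (i < d)%N -> c i `<` c i.+1).

Definition krull_dim A (d : nat) :=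
  (exists c : nat -> set A, prime_chain d c) /\
  (forall e (c : nat -> set A), prime_chain e c -> (e <= d)%N).

Definition nonunits A : set A := [set x | ~ exists y, x * y = 1].

Definition radical A (I : set A) : set A := [set x | exists k, I (x ^+ k)].

(* For A local, [nonunits A] is the maximal ideal. *)
Definition system_of_parameters A (x : seq A) :=
  krull_dim A (size x) /\ radical (ideal_gen [set` x]) = @nonunits A.

Definition part_of_system_of_parameters A (x : seq A) :=
  exists y : seq A, system_of_parameters (x ++ y).

Definition parameters A (r : seq A) :=
  forall P : prime_ideal A, ideal_gen [set` r] `<=` prime_set P ->
    part_of_system_of_parameters [seq to_loc P a | a <- r].

Definition parameter_ideal A (I : set A) :=
  exists2 r : seq A, I = ideal_gen [set` r] & parameters r.

Definition frobenius_power A (I : set A) (q : nat) : set A :=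
  ideal_gen [set a ^+ q | a in I].

Definition tight_closure (p : nat) A (I : set A) : set A :=
  [set r | exists2 c, (forall P, minimal_prime P -> ~ P c) &
    exists e0, forall e, (e0 <= e)%N ->
      frobenius_power I (p ^ e) (c * r ^+ (p ^ e))].

Definition tightly_closed (p : nat) A (I : set A) := I = tight_closure p I.

(* [GRing.pchar] requires a nonzero ring. *)
Definition has_char A (p : nat) := forall m, (m%:R == 0 :> A) = (p %| m)%N.

Definition F_rational (p : nat) A :=
  [/\ noetherian A, prime p, has_char A p &
    forall I : set A, parameter_ideal I -> tightly_closed p I].

Definition geometrically_F_rational (p : nat) (K : fieldType) A
    (phi : {rmorphism K -> A}) :=
  forall (L : fieldType) (iota : {rmorphism K -> L}),
    F_rational p (tensor phi iota).

End FRational.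

Definition square_free_supported (K : fieldType) (n : nat)
    (f : {mpoly K[n]}) :=
  forall m, m \in msupp f -> forall i : 'I_n, (m i <= 1)%N.

Definition irreducible_element (R : idomainType) (a : R) :=
  [/\ a != 0, a \isn't a GRing.unit &
    forall b c, a = b * c -> b \is a GRing.unit \/ c \is a GRing.unit].

Definition mpoly_quot (K : fieldType) (n : nat) (X : set {mpoly K[n]}) :
    {rmorphism K -> ring_quot X} :=
  @ring_quot_pi {mpoly K[n]} X \o @mpolyC n K.

(* Main.v *)
Require Import Defs.
From HB Require Import structures.
From mathcomp Require Import all_boot all_order all_algebra.
From mathcomp Require Import boolp classical_sets.
From mathcomp Require Import ring mpoly.

Set Implicit Arguments.
Unset Strict Implicit.
Unset Printing Implicit Defensive.

Import GRing.Theory.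
Local Open Scope classical_set_scope.
Local Open Scope ring_scope.

(** Let [S] be the polynomial ring over the extension field [L], let [F]
    be the image of [f] in [S], and let [Q] be the ideal of [S] generated
    by the images of the irreducible factors, so that the base change of
    [R] is [S/Q]. Much more than F-rationality holds: every ideal [I] of
    [S/Q] is tightly closed.

    Let [J] be the preimage of [I] in [S]. Since [F^(q-1) Q] lies in the
    ideal generated by the [q]-th powers of the factors, a relation [c
    r^q] in [I^[q]] lifts to [F^(q-1) c r^q] in [J^[q]]. Now [S] is free
    over the ring generated by [L] and the [q]-th powers of the variables,
    with basis the monomials of degree less than [q] in each variable.
    Taking one coordinate ([frob_coord]) turns [F^(q-1) c r^q] into the
    product of the corresponding coordinate of [F^(q-1) c] with [r'],
    where [r'] is [r] with its coefficients raised to the power [q]. If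
    that coordinate of [F^(q-1) c] is a nonzero constant, then [r']
    belongs to the ideal generated by the image of [J] under the Frobenius
    of the coefficients, and linear algebra over [L] ([map_ideal_descent])
    gives [r] in [J]. Coordinates keep their coefficients, so that no root
    of an element of [L] is ever taken and [L] may be imperfect.

    It remains to reach a nonzero constant coordinate. As [F^(qq'-1) =
    F^(q-1) (F^(q'-1))^q], coordinates may be taken repeatedly
    ([frob_test_step]), each time replacing the multiplier [w] by a
    coordinate of [F^(q-1) w] and the coefficients of [F] by their [q]-th
    powers. Because [F] has degree at most one in each variable, one step
    with [q] large makes [w] of degree at most one in each variable, and
    afterwards steps with [q = p] remove the variables of [w] one by one
    ([frob_coord_eliminate]): if [F = a + z b] and [w = w0 + z w1], the
    coefficient of [z] in [F^(p-1) w] is [a^(p-2) (a w1 - b w0)], and for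
    [w] free of a variable [y] this is nonzero as soon as the determinant
    of the coefficients of [1, y, z, yz] in [F] ([coefv_det]) does not
    vanish.

    Irreducibility supplies such pairs. If all these determinants vanish
    for [y] in a set [E] of variables and [z] outside [E], then a factor
    [f_i] splits, up to a constant, as the product of its restrictions
    obtained by specializing the variables in [E], respectively outside
    [E], at a point where [f_i] does not vanish ([peval_product]). Hence,
    starting from one variable [y_i] of each [f_i], all variables can be
    removed ([irreducible_prod_eliminable]). The determinants are computed
    over [K] and stay nonzero over [L], which is why the conclusion
    survives every extension of the field.

    Finally the multiplier [c] has to be made free of the [y_i]. Writing
    [f_i = h_i + y_i g_i], the substitution [y_i = - h_i / g_i] is a
    generic zero of [Q] ([generic_zero]). Modulo [Q], a power of the
    product of the [g_i] times any polynomial is a polynomial free of the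
    [y_i] ([clear_leads]); therefore the kernel of the substitution is a
    minimal prime over [Q] ([ev_prime_minimal]), and a multiplier outside
    all minimal primes may be replaced by a nonzero polynomial free of the
    [y_i].

    That the quotient is Noetherian is Hilbert's basis theorem
    ([hilbert_basis]), and its characteristic is seen at the generic zero. *)

(** * Polynomials seen as polynomials in one of their variables *)

Lemma mpoly_addX_ind n (R : comNzRingType) (P : {mpoly R[n]} -> Prop) :
  P 0 -> (forall c m f, P f -> P (c *: 'X_[m] + f)) -> forall f, P f.
Proof. by move=> P0 PD; elim/mpolyind => // c m f _ _; apply: PD. Qed.

Lemma mpoly_gen_ind n (R : comNzRingType) (P : {mpoly R[n]} -> Prop) :
  (forall c, P c%:MP) -> (forall i, P 'X_i) ->
  (forall f g, P f -> P g -> P (f + g)) ->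
  (forall f g, P f -> P g -> P (f * g)) -> forall f, P f.
Proof.
move=> PC PX PD PM; apply: mpoly_addX_ind; first by rewrite -mpolyC0; apply: PC.
move=> c m f Pf; apply: PD => //; rewrite -mul_mpolyC; apply: (PM) => //.
have P1 : P 1 by rewrite -mpolyC1; apply: PC.
rewrite mpolyXE_id; apply: (big_ind P P1 PM) => i _.
by elim: (m i : nat) => [|k IH]; rewrite ?expr0 // exprS; apply: PM.
Qed.

Lemma mpoly_rmorph_eq n (R : comNzRingType) (S : comPzRingType)
  (f g : {rmorphism {mpoly R[n]} -> S}) :
  (forall c, f c%:MP = g c%:MP) -> (forall i, f 'X_i = g 'X_i) -> f =1 g.
Proof.
move=> fgC fgX x; rewrite (mpolyE x) !rmorph_sum; apply: eq_bigr => m _ /=.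
rewrite -mul_mpolyC !rmorphM fgC; congr (_ * _).
rewrite mpolyXE_id !rmorph_prod; apply: eq_bigr => i _.
by rewrite !rmorphXn fgX.
Qed.

Section OneVariable.
Variables (n : nat) (R : comNzRingType).
Implicit Types (i j : 'I_n) (f g : {mpoly R[n]}) (m : 'X_{1..n}).

Definition uni_var i j : {poly {mpoly R[n]}} :=
  if j == i then 'X else ('X_j)%:P.

Fact uni_key : unit. Proof. by []. Qed.

(** The view of a polynomial as a polynomial in ['X_i], its coefficients
    being kept in the same ring although they do not involve ['X_i]: degrees
    and coefficients in one variable are then inherited from univariate
    polynomials. *)
Definition uni i f : {poly {mpoly R[n]}} :=
  locked_with uni_key (mmap (polyC \o @mpolyC n R) (uni_var i)) f.

Fact uni_is_zmod_morphism i : zmod_morphism (uni i).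
Proof. by move=> f g; rewrite /uni unlock raddfB. Qed.

Fact uni_is_monoid_morphism i : monoid_morphism (uni i).
Proof. by split=> [|f g]; rewrite /uni unlock ?rmorph1 // rmorphM. Qed.

HB.instance Definition _ i := GRing.isZmodMorphism.Build {mpoly R[n]}
  {poly {mpoly R[n]}} (uni i) (uni_is_zmod_morphism i).
HB.instance Definition _ i := GRing.isMonoidMorphism.Build {mpoly R[n]}
  {poly {mpoly R[n]}} (uni i) (uni_is_monoid_morphism i).

Definition coefv i k f : {mpoly R[n]} := (uni i f)`_k.

Definition mdrop i m : 'X_{1..n} :=
  [multinom if j == i then 0%N else m j | j < n].

Lemma uniC i c : uni i c%:MP = (c%:MP)%:P.
Proof. by rewrite /uni unlock /= mmapC. Qed.

Lemma uniXU i j : uni i 'X_j = uni_var i j.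
Proof. by rewrite /uni unlock /= mmapX mmap1U. Qed.

Lemma uniX i m : uni i 'X_[m] = ('X_[mdrop i m])%:P * 'X^(m i).
Proof.
rewrite /uni unlock /= mmapX /mmap1 [X in _ = X%:P * _]mpolyXE_id rmorph_prod
  /=.
rewrite (bigD1 i) //= [X in _ = X * _](bigD1 i) //= /uni_var eqxx.
rewrite mnmE eqxx expr0 mul1r mulrC; congr (_ * _).
by apply: eq_bigr => j /negPf nji; rewrite nji mnmE nji rmorphXn.
Qed.

Lemma uniD i f g : uni i (f + g) = uni i f + uni i g.
Proof. exact: rmorphD. Qed.

Lemma uniM i f g : uni i (f * g) = uni i f * uni i g.
Proof. exact: rmorphM. Qed.

Lemma coefvD i k f g : coefv i k (f + g) = coefv i k f + coefv i k g.
Proof. by rewrite /coefv uniD coefD. Qed.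

Lemma coefvCX i k c m :
  coefv i k (c *: 'X_[m]) = (c * (k == m i)%:R) *: 'X_[mdrop i m].
Proof.
rewrite /coefv -mul_mpolyC uniM uniC uniX mulrA -polyCM.
rewrite coefCM coefXn mul_mpolyC.
by case: (k == m i); rewrite ?mulr1 // !mulr0 scale0r.
Qed.

Lemma mcoeff_coefv i k f m :
  (coefv i k f)@_m = if m i == 0%N then f@_(m + U_(i) *+ k) else 0.
Proof.
elim/mpoly_addX_ind: f => [|c u f IH].
  by rewrite /coefv rmorph0 coef0 !mcoeff0 if_same.
rewrite coefvD coefvCX !mcoeffD {}IH !mcoeffZ !mcoeffX -mulrA -natrM mulnb.
have -> : (k == u i) && (mdrop i u == m) =
          (m i == 0%N) && (u == (m + U_(i) *+ k)%MM).
  apply/andP/andP => [[/eqP-> /eqP<-]|[/eqP mi /eqP->]].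
    rewrite mnmE eqxx; split=> //; apply/eqP/mnmP => j.
    rewrite mnmDE mnmE mulmnE mnm1E [i == j]eq_sym.
    by case: eqP => [->|_]; rewrite ?mul1n ?mul0n ?addn0.
  rewrite mnmDE mulmnE mnm1E eqxx mi mul1n; split=> //; apply/eqP/mnmP => j.
  rewrite mnmE mnmDE mulmnE mnm1E [i == j]eq_sym.
  by case: eqP => [->|_]; rewrite ?mi ?mul0n ?addn0.
by case: ifP => _; rewrite // mulr0 addr0.
Qed.

Lemma uni_horner i f : (uni i f).['X_i] = f.
Proof.
elim/mpoly_addX_ind: f => [|c u f IH]; first by rewrite rmorph0 horner0.
rewrite uniD hornerD [X in _ + X = _]IH; congr (_ + _).
rewrite -mul_mpolyC uniM uniC uniX hornerCM hornerM hornerC hornerXn.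
congr (_ * _).
rewrite mulrC [in RHS]mpolyXE_id (bigD1 i) //=; congr (_ * _).
rewrite mpolyXE_id (bigD1 i) //= mnmE eqxx expr0 mul1r.
by apply: eq_bigr => j /negPf ji; rewrite mnmE ji.
Qed.

(** The degree in ['X_i], with value [0] on the zero polynomial. *)
Definition degv i f := (size (uni i f)).-1.

(** The link between degrees computed through [uni], which behave well for
    products, and exponents of monomials. *)
Lemma degv_leP i d f :
  reflect (forall m, m \in msupp f -> (m i <= d)%N) (degv i f <= d)%N.
Proof.
apply: (iffP idP) => [le_d m|le_d].
  rewrite mcoeff_msupp; apply: contraR; rewrite -ltnNge => lt_d.
  have := mcoeff_coefv i (m i) f (mdrop i m); rewrite mnmE eqxx /=.
  have -> : (mdrop i m + U_(i) *+ m i)%MM = m.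
    apply/mnmP => j; rewrite mnmDE mnmE mulmnE mnm1E [i == j]eq_sym.
    by case: eqP => [->|_]; rewrite ?mul1n ?mul0n ?addn0.
  move=> <-; rewrite /coefv nth_default ?mcoeff0 //.
  by apply: leq_trans lt_d; move: le_d; rewrite /degv; case: size.
rewrite -ltnS /degv; apply: (@leq_ltn_trans (d.+1).-1) => //.
suff : (size (uni i f) <= d.+1)%N by case: size.
apply/leq_sizeP => k lt_dk; apply/mpolyP => m.
rewrite -/(coefv i k f) mcoeff_coefv mcoeff0; case: ifP => // /eqP mi.
apply/eqP; rewrite mcoeff_eq0; apply/negP => /le_d.
by rewrite mnmDE mulmnE mnm1E eqxx mi mul1n leqNgt lt_dk.
Qed.

Lemma size_uni_le i d f : (degv i f <= d)%N = (size (uni i f) <= d.+1)%N.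
Proof. by rewrite /degv; case: size. Qed.

Lemma coefv_gt i k f : (degv i f < k)%N -> coefv i k f = 0.
Proof.
by move=> lt; rewrite /coefv nth_default //; move: lt; rewrite /degv;
  case: size.
Qed.

Lemma degv0_uni i f : degv i f = 0%N -> uni i f = f%:P.
Proof.
move=> d0; have : (size (uni i f) <= 1)%N by rewrite -size_uni_le d0.
by move=> /size1_polyC e; rewrite -[in RHS](uni_horner i f) e hornerC.
Qed.

Lemma uni_degv0 i f g : uni i f = g%:P -> degv i f = 0%N.
Proof. by rewrite /degv => ->; rewrite size_polyC; case: (g != 0). Qed.

Lemma degv_coefv_le i j k f : (degv j (coefv i k f) <= degv j f)%N.
Proof.
apply/degv_leP => m; rewrite mcoeff_msupp mcoeff_coefv.
case: ifP; rewrite ?eqxx // => _; rewrite -mcoeff_msupp => mf.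
have /degv_leP/(_ _ mf) := leqnn (degv j f).
by apply: leq_trans; rewrite mnmDE leq_addr.
Qed.

Lemma degv_coefv_same i k f : degv i (coefv i k f) = 0%N.
Proof.
apply/eqP; rewrite -leqn0; apply/degv_leP => m;
  rewrite mcoeff_msupp mcoeff_coefv.
by case: ifP => [/eqP->|_]; rewrite ?eqxx.
Qed.

Lemma degv1E i f : (degv i f <= 1)%N -> f = coefv i 0 f + 'X_i * coefv i 1 f.
Proof.
rewrite size_uni_le => s2; rewrite -[LHS](uni_horner i f).
by rewrite (horner_coef_wide _ s2) !big_ord_recl big_ord0 /= expr0 mulr1 addr0
  mulrC.
Qed.

Lemma coefvM_free i k f g : degv i g = 0%N ->
  coefv i k (f * g) = coefv i k f * g.
Proof. by move=> dg; rewrite /coefv uniM (degv0_uni dg) coefMC. Qed.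

Lemma degvC i c : degv i c%:MP = 0%N.
Proof. exact: uni_degv0 (uniC i c). Qed.

Lemma degv_all0 f : (forall i, degv i f = 0%N) -> f = (f@_0)%:MP.
Proof.
move=> d0; apply/mpolyP => m; rewrite mcoeffC.
have [->|nm] := eqVneq m 0%MM; first by rewrite mulr1.
rewrite mulr0; apply: memN_msupp_eq0; apply: contra nm => mf.
apply/eqP/mnmP => i; have /degv_leP/(_ _ mf) : (degv i f <= 0)%N by rewrite d0.
by rewrite leqn0 mnm0E => /eqP.
Qed.

Lemma degvD_le i d f g :
  (degv i f <= d)%N -> (degv i g <= d)%N -> (degv i (f + g) <= d)%N.
Proof.
rewrite !size_uni_le => hf hg; rewrite uniD.
by rewrite (leq_trans (size_polyD _ _)) // geq_max hf.
Qed.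

Lemma degvM_le i f g : (degv i (f * g) <= degv i f + degv i g)%N.
Proof.
rewrite size_uni_le uniM (leq_trans (size_polyMleq _ _)) //.
by rewrite /degv; case: size => [|a]; case: size => [|b] //=;
  rewrite ?addn0 ?addnS.
Qed.

Lemma degvX_le i f k : (degv i (f ^+ k) <= k * degv i f)%N.
Proof.
elim: k => [|k IH]; first by rewrite expr0 -mpolyC1 degvC.
by rewrite exprS mulSn (leq_trans (degvM_le _ _ _)) // leq_add2l.
Qed.

Lemma degvXU i j : (degv i ('X_j : {mpoly R[n]}) <= (j == i))%N.
Proof.
rewrite size_uni_le uniXU /uni_var; case: eqP => _; first by rewrite size_polyX.
exact: size_polyC_leq1.
Qed.

End OneVariable.
Arguments uni {n R} i.

(** Over a domain the leading coefficients in ['X_i] do not cancel, whence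
    variables of different factors of a polynomial of degree at most one are
    different. *)
Lemma degvM n (R : idomainType) i (f g : {mpoly R[n]}) : f != 0 -> g != 0 ->
  degv i (f * g) = (degv i f + degv i g)%N.
Proof.
have uni0 (h : {mpoly R[n]}) : h != 0 -> uni i h != 0.
  by apply: contra_neq => e; rewrite -(uni_horner i h) e horner0.
move=> /uni0 f0 /uni0 g0; rewrite /degv uniM size_mul //.
by rewrite -!size_poly_gt0 in f0 g0; case: size f0 => // a; case: size g0 =>
  // b _ _ /=; rewrite addnS.
Qed.

Section MapCoefficients.
Variables (n : nat) (R S : comNzRingType) (s : {rmorphism R -> S}).
Implicit Types (f : {mpoly R[n]}).

Lemma coefv_map i k f : coefv i k (map_mpoly s f) = map_mpoly s (coefv i k f).
Proof.
apply/mpolyP => m; rewrite mcoeff_coefv !mcoeff_map_mpoly mcoeff_coefv.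
by case: ifP => // _; rewrite raddf0.
Qed.

Lemma map_mpolyD f g : map_mpoly s (f + g) = map_mpoly s f + map_mpoly s g.
Proof. exact: raddfD. Qed.

Lemma map_mpolyCX c m : map_mpoly s (c *: 'X_[m]) = s c *: 'X_[m] :> {mpoly
  S[n]}.
Proof.
apply/mpolyP => k; rewrite mcoeff_map_mpoly !mcoeffZ !mcoeffX.
by case: eqP => _; rewrite ?mulr1 // !mulr0 raddf0.
Qed.

Lemma degv_map_le i f : (degv i (map_mpoly s f) <= degv i f)%N.
Proof.
apply/degv_leP => m; rewrite mcoeff_msupp mcoeff_map_mpoly => ne.
have /degv_leP := leqnn (degv i f); apply; rewrite mcoeff_msupp.
by apply: contra_neq ne => ->; rewrite raddf0.
Qed.
End MapCoefficients.

(** * Coordinates over q-th powers, and descent along Frobenius *)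

Section IdealSums.
Variable A : comPzRingType.
Implicit Types (I X : set A).

Lemma ideal_sum I (T : eqType) (s : seq T) (F : T -> A) : is_ideal I ->
  (forall z, z \in s -> I (F z)) -> I (\sum_(z <- s) F z).
Proof.
move=> [I0 ID _] H; rewrite big_seq; elim/big_rec: _ => // z x zs Ix.
by apply: ID => //; apply: H.
Qed.

Lemma idealB I a b : is_ideal I -> I a -> I b -> I (a - b).
Proof. by move=> [_ ID IM] Ia Ib; apply: ID => //; rewrite -mulN1r;
  apply: IM. Qed.

Lemma ideal_genP X c : ideal_gen X c -> exists2 s : seq (A * A),
  (forall z, z \in s -> X z.2) & c = \sum_(z <- s) z.1 * z.2.
Proof.
move: c; apply: ideal_gen_min => [|x Xx]; last first.
  exists [:: (1, x)]; last by rewrite big_seq1 mul1r.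
  by move=> z; rewrite inE => /eqP->.
split; first by exists [::]; rewrite ?big_nil.
  move=> a b [s sX ->] [t tX ->]; exists (s ++ t); last by rewrite big_cat.
  by move=> z; rewrite mem_cat => /orP[/sX|/tX].
move=> a b [s sX ->]; exists [seq (a * z.1, z.2) | z <- s].
  by move=> z /mapP[w ws ->]; apply: (sX w).
by rewrite big_map mulr_sumr; apply: eq_bigr => z _; rewrite mulrA.
Qed.

Lemma prime_exp (P : set A) a N : is_prime P -> P (a ^+ N) -> P a.
Proof.
move=> [_ P1 PM]; elim: N => [//|N IH].
by rewrite exprS => /PM[].
Qed.

End IdealSums.

Section FrobeniusCoordinates.
Variables (n : nat) (R : comNzRingType) (q : nat).
Hypothesis q_gt0 : (0 < q)%N.
Implicit Types (f g h : {mpoly R[n]}) (u v m k : 'X_{1..n}).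

Definition mdivn m : 'X_{1..n} := [multinom (m i %/ q)%N | i < n].
Definition mmodn m : 'X_{1..n} := [multinom (m i %% q)%N | i < n].

(** Over the ring generated by the coefficients and the [q]-th powers of the
    variables, polynomials have as basis the monomials with exponents less
    than [q]. This is the coordinate along the monomial congruent to [u]
    modulo [q], with ['X_i ^+ q] renamed ['X_i]. Indexing by an arbitrary
    [u] instead of its remainder spares a side condition. *)
Definition frob_coord u g : {mpoly R[n]} :=
  \sum_(v <- msupp g | mmodn v == mmodn u) g@_v *: 'X_[mdivn v].

Lemma mdivn_eq m : (mmodn m + mdivn m *+ q)%MM = m.
Proof. by apply/mnmP => i; rewrite mnmDE mulmnE !mnmE addnC -divn_eq. Qed.

Lemma mdivmodn_eq u v k :
  (mmodn v == mmodn u) && (mdivn v == k) = (v == (mmodn u + k *+ q)%MM).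
Proof.
apply/andP/eqP => [[/eqP<- /eqP<-]|->]; first by rewrite mdivn_eq.
split; apply/eqP/mnmP => i; rewrite mnmE mnmDE mulmnE !mnmE.
  by rewrite addnC modnMDl modn_mod.
by rewrite addnC divnMDl // divn_small ?addn0 // ltn_mod.
Qed.

Lemma mcoeff_frob_coord u g k :
  (frob_coord u g)@_k = g@_(mmodn u + k *+ q).
Proof.
rewrite [in RHS](mpolyE g) !raddf_sum big_mkcond /=; apply: eq_bigr => v _.
rewrite !mcoeffZ !mcoeffX -mdivmodn_eq.
by case: (mmodn v == mmodn u); rewrite ?mcoeffZ ?mcoeffX ?mcoeff0 ?mulr0.
Qed.

Lemma frob_coordD u g h :
  frob_coord u (g + h) = frob_coord u g + frob_coord u h.
Proof. by apply/mpolyP => k; rewrite mcoeffD !mcoeff_frob_coord mcoeffD. Qed.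

Lemma frob_coord0 u : frob_coord u 0 = 0.
Proof. by apply/mpolyP => k; rewrite mcoeff_frob_coord !mcoeff0. Qed.

Lemma frob_coord_sum u (T : Type) (s : seq T) (F : T -> {mpoly R[n]}) :
  frob_coord u (\sum_(z <- s) F z) = \sum_(z <- s) frob_coord u (F z).
Proof. by apply: big_morph; [apply: frob_coordD|apply: frob_coord0]. Qed.

Lemma frob_coordCX u c v : frob_coord u (c *: 'X_[v]) =
  (c * (mmodn v == mmodn u)%:R) *: 'X_[mdivn v].
Proof.
apply/mpolyP => k; rewrite mcoeff_frob_coord !mcoeffZ !mcoeffX -mdivmodn_eq.
by rewrite -mulrA -natrM mulnb.
Qed.

Lemma degv_frob_coord_le i d u g : (degv i g <= d)%N ->
  (degv i (frob_coord u g) <= d %/ q)%N.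
Proof.
move=> /degv_leP le_d; apply/degv_leP => m; rewrite mcoeff_msupp.
rewrite mcoeff_frob_coord -mcoeff_msupp => /le_d;
  rewrite mnmDE mulmnE leq_divRL //.
by apply: leq_trans; rewrite leq_addl.
Qed.

Lemma frob_coord_neq0 u g : u \in msupp g -> frob_coord u g != 0.
Proof.
rewrite mcoeff_msupp; apply: contra_neq => e.
by rewrite -{1}(mdivn_eq u) -mcoeff_frob_coord e mcoeff0.
Qed.

End FrobeniusCoordinates.

Section Frobenius.
Variables (p : nat) (L : fieldType) (charL : p \in [pchar L]) (e : nat).

Definition frob (x : L) : L := x ^+ (p ^ e).

Lemma pnat_frob : [pchar L].-nat (p ^ e)%N.
Proof. by rewrite pnatX pnatE ?charL // (pcharf_prime charL). Qed.

Fact frob_is_zmod_morphism : zmod_morphism frob.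
Proof.
move=> x y; apply/eqP; rewrite eq_sym subr_eq /frob.
by rewrite -exprDn_pchar ?subrK // pnat_frob.
Qed.

Fact frob_is_monoid_morphism : monoid_morphism frob.
Proof. by split=> [|x y]; rewrite /frob ?expr1n // exprMn. Qed.

Definition frobm : {rmorphism L -> L} :=
  HB.pack frob (GRing.isZmodMorphism.Build L L frob frob_is_zmod_morphism)
   (GRing.isMonoidMorphism.Build L L frob frob_is_monoid_morphism).

Lemma frobmE x : frobm x = x ^+ (p ^ e).
Proof. by []. Qed.

End Frobenius.

Section FrobeniusMpoly.
Variables (p : nat) (L : fieldType) (charL : p \in [pchar L]) (n : nat).
Implicit Types (f g h : {mpoly L[n]}) (u v m k : 'X_{1..n}).

Lemma mpoly_pchar : p \in [pchar {mpoly L[n]}].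
Proof. by rewrite (rmorph_pchar (@mpolyC n L)). Qed.

Lemma pexpn_gt0 e : (0 < p ^ e)%N.
Proof. by rewrite expn_gt0 prime_gt0 // (pcharf_prime charL). Qed.

(** The coordinate map is linear over [q]-th powers: [h ^+ q] is [h] with
    its coefficients raised to the power [q], evaluated at the [q]-th powers
    of the variables, and the second operation is undone by the renaming in
    [frob_coord]. *)
Lemma frob_coordMX e u g h : frob_coord (p ^ e) u (g * h ^+ (p ^ e)) =
  frob_coord (p ^ e) u g * map_mpoly (frobm charL e) h.
Proof.
have q0 := pexpn_gt0 e; set q := (p ^ e)%N in q0 *.
have qn : [pchar {mpoly L[n]}].-nat q.
  by rewrite pnatX pnatE ?mpoly_pchar // (pcharf_prime charL).
move: h; apply: mpoly_addX_ind => [|d m h IH].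
  by rewrite raddf0 expr0n gtn_eqF //= !mulr0 frob_coord0.
rewrite map_mpolyD exprDn_pchar // !mulrDr frob_coordD //.
rewrite [X in _ + X = _]IH; congr (_ + _).
rewrite exprZn mpolyXn map_mpolyCX frobmE -/q.
move: {IH}g; apply: mpoly_addX_ind => [|c v g IHg].
  by rewrite !mul0r frob_coord0 // mul0r.
rewrite mulrDl !frob_coordD // mulrDl IHg; congr (_ + _).
rewrite -scalerAl -scalerAr scalerA -mpolyXD !frob_coordCX //.
rewrite -scalerAl -scalerAr scalerA -mpolyXD.
have -> : mdivn q (v + m *+ q) = (mdivn q v + m)%MM.
  by apply/mnmP => i; rewrite !(mnmDE, mnmE, mulmnE) addnC divnMDl // addnC.
have -> : mmodn q (v + m *+ q) = mmodn q v.
  by apply/mnmP => i; rewrite !(mnmDE, mnmE, mulmnE) addnC modnMDl.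
by rewrite -mulrA [X in c * X]mulrC mulrA.
Qed.

End FrobeniusMpoly.

Section Descent.
Variables (n : nat) (L L' : fieldType) (s : {rmorphism L -> L'}).
Implicit Types (I : set {mpoly L[n]}).
Notation ms := (map_mpoly s).

(** Multiplying a generator by a monomial with coefficient in [L'] leaves
    its monomial part in [I]; thus scalars from [L'] suffice as multipliers. *)
Lemma map_ideal_combination I x : is_ideal I ->
  ideal_gen [set ms a | a in I] x ->
  exists2 l : seq (L' * {mpoly L[n]}), (forall z, z \in l -> I z.2) &
    x = \sum_(z <- l) z.1 *: ms z.2.
Proof.
move=> II; have [I0 ID IM] := II; move: x; apply: ideal_gen_min =>
  [|_ [a Ia <-]].
  split; first by exists [::]; rewrite ?big_nil.
    move=> a b [k kI ->] [l lI ->]; exists (k ++ l); last by rewrite big_cat.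
    by move=> z; rewrite mem_cat => /orP[/kI|/lI].
  move=> a b [l lI eb]; move: a; apply: mpoly_addX_ind => [|c m a [k kI e]].
    by exists [::]; rewrite ?big_nil ?mul0r.
  exists ([seq (c * z.1, 'X_[m] * z.2) | z <- l] ++ k).
    move=> z; rewrite mem_cat => /orP[/mapP[w wl ->]|/kI//].
    exact/IM/lI.
  rewrite big_cat big_map mulrDl -e; congr (_ + _).
  rewrite eb mulr_sumr; apply: eq_bigr => z _ /=.
  by rewrite rmorphM /= map_mpolyX -scalerAl -scalerAr scalerA.
exists [:: (1, a)]; last by rewrite big_seq1 scale1r.
by move=> z; rewrite inE => /eqP->.
Qed.

(** A field extension does not enlarge the traces of ideals: membership is
    the solvability of a finite linear system with coefficients in the image
    of [L], and the rank of a matrix does not change under field extensions.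
    It is used for the Frobenius endomorphism of an imperfect field. *)
Lemma map_ideal_descent I r : is_ideal I ->
  ideal_gen [set ms a | a in I] (ms r) -> I r.
Proof.
move=> II /(map_ideal_combination II) [l lI e].
(* All monomials of r and of the generators have degree less than d, so that
   they can index the columns of a matrix. *)
pose d := maxn (msize r) (\max_(z <- l) msize z.2).
pose T : finType := 'X_{1..n < d}; pose t := in_tuple l.
pose B : 'M[L]_(size l, #|T|) := \matrix_(i, j) (tnth t i).2@_(bmnm (enum_val j
  : 'X_{1..n < d})).
pose rho : 'rV[L]_#|T| := \row_j r@_(bmnm (enum_val j : 'X_{1..n < d})).
have : (map_mx s rho <= map_mx s B)%MS.
  apply/submxP; exists (\row_i (tnth t i).1); apply/rowP => j.
  rewrite !mxE -mcoeff_map_mpoly e raddf_sum /= (big_tnth _ _ l).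
  by apply: eq_bigr => i _; rewrite !mxE mcoeffZ mcoeff_map_mpoly.
rewrite map_submx => /submxP[c ec].
have -> : r = \sum_(i < size l) (c 0 i)%:MP * (tnth t i).2.
  apply/mpolyP => m; rewrite raddf_sum /=.
  have [lt_md|le_dm] := ltnP (mdeg m) d.
    have /rowP/(_ (enum_rank (BMultinom lt_md))) := ec.
    rewrite !mxE enum_rankK /= => ->; apply: eq_bigr => i _.
    by rewrite !mxE enum_rankK mcoeffCM.
  have big g : (msize g <= d)%N -> g@_m = 0.
    by move=> gd; apply/memN_msupp_eq0/msize_mdeg_ge/(leq_trans gd).
  rewrite big ?leq_maxl // big1 // => i _; rewrite mcoeffCM big ?mulr0 //.
  rewrite /d leq_max; apply/orP; right.
  exact: (@leq_bigmax_seq _ l xpredT (fun z => msize z.2) _ (mem_tnth i t)).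
apply: (ideal_sum (s := index_enum _)) => // i _.
by have [_ _ IM] := II; apply/IM/lI/mem_tnth.
Qed.

End Descent.

Section FrobeniusTest.
Variables (p : nat) (L : fieldType) (charL : p \in [pchar L]) (n : nat).
Implicit Types (f w : {mpoly L[n]}).

(** The multiplier [w] detects membership: for some [q = p^e] with [e] at
    least [e0], the relation [f^(q-1) w r^q] in [I^[q]] forces [r] in [I],
    for all [I] and [r] at once. The lower bound on [e] is what tight
    closure needs, its relations being available only for large [e]. *)
Definition frob_test e0 f w := exists2 e, (e0 <= e)%N &
  forall I r, is_ideal I ->
    frobenius_power I (p ^ e) (f ^+ (p ^ e).-1 * w * r ^+ (p ^ e)) -> I r.

Lemma frob_test_leq e0 e1 f w : (e0 <= e1)%N -> frob_test e1 f w ->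
  frob_test e0 f w.
Proof. by move=> le01 [e le_e H]; exists e => //; apply: leq_trans le_e. Qed.

Lemma frob_test_const f c : c != 0 -> frob_test 0 f c%:MP.
Proof.
move=> c0; exists 0%N => // I r II; rewrite expn0 expr0 mul1r expr1.
move=> H; have : I (c%:MP * r).
  by move: H; apply: ideal_gen_min => // _ [a Ia <-]; rewrite expr1.
have [_ _ IM] := II; move=> /(IM (c^-1)%:MP).
by rewrite mulrA -mpolyCM mulVf // mpolyC1 mul1r.
Qed.

(** Taking the coordinate at [u] of a relation with exponent [q q'], where
    [q = p^e1], yields a relation with exponent [q'] for the new multiplier
    and for [f], [I] and [r] with coefficients raised to the power [q]; the
    descent lemma then brings the conclusion back to [I] and [r]. *)
Lemma frob_test_step e1 e2 u f w :
  frob_test e2 (map_mpoly (frobm charL e1) f)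
    (frob_coord (p ^ e1) u (f ^+ (p ^ e1).-1 * w)) ->
  frob_test (e1 + e2) f w.
Proof.
move=> [e le_e He]; exists (e1 + e)%N; first by rewrite leq_add2l.
move=> I r II H; apply: (map_ideal_descent (s := frobm charL e1) II).
apply: He; first exact: ideal_gen_ideal.
have q0 := pexpn_gt0 charL e1; have q1 := pexpn_gt0 charL e.
set s := frobm charL e1; rewrite -!(rmorphXn (map_mpoly s)) mulrAC.
rewrite -(rmorphM (map_mpoly s)) mulrC -frob_coordMX.
set x := (X in frob_coord _ _ X).
have -> : x = f ^+ (p ^ (e1 + e)).-1 * w * r ^+ (p ^ (e1 + e)).
  rewrite /x exprMn -!exprM mulrACA -exprD mulrA.
  rewrite expnD [(p ^ e * _)%N]mulnC; congr (_ ^+ _ * _ * _).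
  move: (p ^ e1)%N (p ^ e)%N q0 q1 => [//|a] [//|b] _ _.
  by rewrite [in RHS]mulnS addSn !succnK mulnC.
have [l lI ->] := ideal_genP H; rewrite frob_coord_sum //.
apply: ideal_sum => [|z /lI [a Ia <-]]; first exact: ideal_gen_ideal.
rewrite expnD mulnC exprM frob_coordMX rmorphXn.
have [_ _ IM] := ideal_gen_ideal [set a ^+ (p ^ e) | a in ideal_gen [set
  map_mpoly s a | a in I]].
apply: (IM); apply: sub_ideal_gen; exists (map_mpoly s a) => //.
by apply: sub_ideal_gen; exists a.
Qed.

End FrobeniusTest.

(** * Elimination of the variables of a multiplier *)

Lemma coef0X (S : comNzRingType) (P : {poly S}) k : (P ^+ k)`_0 = P`_0 ^+ k.
Proof. by rewrite -!horner_coef0 horner_exp. Qed.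

Lemma coef1X (S : comNzRingType) (P : {poly S}) k :
  (P ^+ k.+1)`_1 = (P`_0 ^+ k * P`_1) *+ k.+1.
Proof.
elim: k => [|k IH]; first by rewrite expr0 mul1r.
rewrite exprS coefM !big_ord_recl big_ord0 /= subn0 subnn addr0 IH coef0X.
by rewrite mulrnAr mulrA -exprS [P`_1 * _]mulrC -mulrSr.
Qed.

Lemma det2_kernel (S : comNzRingType) (a0 a1 b0 b1 x y : S) :
  a0 * y = b0 * x -> a1 * y = b1 * x ->
  (a0 * b1 - a1 * b0) * x = 0 /\ (a0 * b1 - a1 * b0) * y = 0.
Proof.
move=> e0 e1; split.
  have -> : (a0 * b1 - a1 * b0) * x = a0 * (b1 * x) - a1 * (b0 * x) by ring.
  by rewrite -e0 -e1; ring.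
have -> : (a0 * b1 - a1 * b0) * y = b1 * (a0 * y) - b0 * (a1 * y) by ring.
by rewrite e0 e1; ring.
Qed.

Section Determinant.
Variable n : nat.

Definition multiaffine (R : comNzRingType) (f : {mpoly R[n]}) :=
  forall i, (degv i f <= 1)%N.

(** The determinant of the coefficients of [1], ['X_y], ['X_z] and ['X_y *
    'X_z] in [f], arranged as a two by two matrix. For [f] of degree at most
    one in both variables, over a domain, it vanishes exactly when [f] has
    rank at most one as a bilinear form in [(1, 'X_y)] and [(1, 'X_z)]. *)
Definition coefv_det (R : comNzRingType) y z (f : {mpoly R[n]}) :=
  coefv y 0 (coefv z 0 f) * coefv y 1 (coefv z 1 f)
  - coefv y 1 (coefv z 0 f) * coefv y 0 (coefv z 1 f).

Lemma coefv_det_map (R S : comNzRingType) (s : {rmorphism R -> S}) y z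
  (f : {mpoly R[n]}) :
  coefv_det y z (map_mpoly s f) = map_mpoly s (coefv_det y z f).
Proof.
by rewrite /coefv_det !coefv_map [RHS]raddfB /= !(rmorphM (map_mpoly s)).
Qed.

Lemma map_mpoly_eq0 (K L : fieldType) (s : {rmorphism K -> L})
  (f : {mpoly K[n]}) : (map_mpoly s f == 0) = (f == 0).
Proof.
apply/eqP/eqP => [e|->]; last exact: raddf0.
apply/mpolyP => m; apply: (fmorph_inj s).
by rewrite -mcoeff_map_mpoly e !mcoeff0 raddf0.
Qed.

(** The variables outside [Y] can be removed successively, each because it
    does not occur in [f] or because of its determinant with a variable
    removed before. Only the vanishing of polynomials in the coefficients of
    [f] is involved, so that the property survives extensions of the field. *)
Definition eliminable (R : comNzRingType) (Y : {set 'I_n}) (f : {mpoly R[n]}) :=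
  forall E : {set 'I_n}, Y \subset E -> E != [set: 'I_n]%SET ->
  exists2 z, z \notin E &
    degv z f = 0%N \/ exists2 y, y \in E & coefv_det y z f != 0.

Lemma multiaffine_map (R S : comNzRingType) (s : {rmorphism R -> S})
  (f : {mpoly R[n]}) : multiaffine f -> multiaffine (map_mpoly s f).
Proof. by move=> mf i; apply: leq_trans (degv_map_le s i f) (mf i). Qed.

Lemma eliminable_map (K L : fieldType) (s : {rmorphism K -> L}) Y
  (f : {mpoly K[n]}) : eliminable Y f -> eliminable Y (map_mpoly s f).
Proof.
move=> ef E YE ET; have [z zE [dz|[y yE d]]] := ef E YE ET; exists z => //.
  by left; apply/eqP; rewrite -leqn0 -dz degv_map_le.
by right; exists y => //; rewrite coefv_det_map map_mpoly_eq0.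
Qed.

End Determinant.

Section Elimination.
Variables (p : nat) (L : fieldType) (charL : p \in [pchar L]) (n : nat).
Implicit Types (f w : {mpoly L[n]}) (u : 'X_{1..n}) (i y z : 'I_n).

Let p_prime : prime p := pcharf_prime charL.
Let p_gt0 : (0 < p)%N := prime_gt0 p_prime.

Lemma degv_power_le q f w i d : multiaffine f -> (degv i w <= d)%N ->
  (degv i (f ^+ q * w) <= q + d)%N.
Proof.
move=> mf dw; apply: leq_trans (degvM_le _ _ _) _; apply: leq_add => //.
by apply: leq_trans (degvX_le _ _ _) _; rewrite -[X in (_ <= X)%N]muln1 leq_mul.
Qed.

(** The exponents of [f ^+ q.-1 * w] are less than [2 q], and less than [q]
    in the variables that [w] does not involve; hence variables that have
    been removed never come back. *)
Lemma degv_frob_coord_power q f w u i : (0 < q)%N -> multiaffine f ->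
  (degv i w <= q)%N ->
  (degv i (frob_coord q u (f ^+ q.-1 * w)) <= 1)%N /\
  (degv i w = 0%N -> degv i (frob_coord q u (f ^+ q.-1 * w)) = 0%N).
Proof.
move=> q0 mf dw; split=> [|d0].
  apply: leq_trans (degv_frob_coord_le q0 u (degv_power_le q.-1 mf dw)) _.
  by rewrite -ltnS ltn_divLR // mulSn mul1n ltn_add2r prednK.
apply/eqP; rewrite -leqn0.
have {}d0 : (degv i w <= 0)%N by rewrite d0.
apply: leq_trans (degv_frob_coord_le q0 u (degv_power_le q.-1 mf d0)) _.
by rewrite addn0 divn_small // prednK.
Qed.

(** In characteristic [p] the binomial coefficient [p - 1] in the expansion
    of [(a + z b)^(p-1)] is [-1]. *)
Lemma coefv1_power f w z : coefv z 1 (f ^+ p.-1 * w) =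
  coefv z 0 f ^+ p.-2 * (coefv z 0 f * coefv z 1 w - coefv z 1 f * coefv z 0 w).
Proof.
rewrite /coefv uniM [uni z _](rmorphXn (uni z)) coefM !big_ord_recl big_ord0 /=.
rewrite subn0 subnn addr0 coef0X.
have -> : p.-1 = p.-2.+1 by have := prime_gt1 p_prime; case: (p) => [|[|]].
rewrite coef1X succnK exprSr mulrBr mulrA; congr (_ + _).
have p2 : p.-2.+2 = p by have := prime_gt1 p_prime; case: (p) => [|[|]].
set x := _ * (uni z f)`_1.
have : x *+ p = 0 by rewrite (mulrn_pchar (mpoly_pchar charL n)).
by rewrite -{1}p2 mulrSr => /eqP; rewrite addr_eq0 mulrA -mulNr => /eqP ->.
Qed.

(** By [coefv1_power] the coefficient of ['X_z] in [f ^+ p.-1 * w] is, up to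
    a power of [coefv z 0 f], the determinant of [f] and [w] with respect to
    ['X_z]; were it zero, the coefficients of [w], free of ['X_y], would be
    killed by [coefv_det y z f]. A coordinate at a monomial with exponent
    [1] in ['X_z] could only involve ['X_z] through the exponent [1 + p] or
    more, which exceeds the degree [p]. *)
Lemma frob_coord_eliminate f w y z : multiaffine f -> multiaffine w -> w != 0 ->
  degv y w = 0%N -> coefv_det y z f != 0 ->
  exists u, frob_coord p u (f ^+ p.-1 * w) != 0 /\
    degv z (frob_coord p u (f ^+ p.-1 * w)) = 0%N.
Proof.
move=> mf mw w0 dy; rewrite /coefv_det.
set a := coefv z 0 f; set b := coefv z 1 f => D0.
have a0 : a != 0 by apply: contra_neq D0 => ->;
  rewrite /coefv !raddf0 !coef0 !mul0r subrr.
have dw k : degv y (coefv z k w) = 0%N.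
  by apply/eqP; rewrite -leqn0 -dy degv_coefv_le.
have r0 : a * coefv z 1 w - b * coefv z 0 w != 0.
  apply: contra_neq w0 => /subr0_eq e.
  have e0 := congr1 (coefv y 0) e; have e1 := congr1 (coefv y 1) e.
  rewrite !coefvM_free // in e0 e1.
  rewrite (degv1E (mw z)); suff [-> ->] : coefv z 0 w = 0 /\ coefv z 1 w = 0.
    by rewrite mulr0 addr0.
  have [x0 y0] := det2_kernel e0 e1.
  by split; apply: (mulfI D0); rewrite mulr0.
have : coefv z 1 (f ^+ p.-1 * w) != 0 by rewrite coefv1_power mulf_neq0 //
  expf_neq0.
rewrite -msupp_eq0; case E: (msupp _) => [//|v s] _.
have : v \in msupp (coefv z 1 (f ^+ p.-1 * w)) by rewrite E mem_head.
rewrite mcoeff_msupp mcoeff_coefv; case: ifP => [/eqP vz|_]; rewrite ?eqxx //.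
rewrite -mcoeff_msupp => vs; exists (v + U_(z))%MM.
split; first exact: frob_coord_neq0.
apply/eqP; rewrite -leqn0; apply/degv_leP => k; rewrite mcoeff_msupp.
rewrite mcoeff_frob_coord // -mcoeff_msupp.
have /degv_leP H := degv_power_le p.-1 mf (mw z).
move=> /H; rewrite mnmDE mulmnE mnmE mnmDE mnm1E eqxx vz add0n.
rewrite modn_small ?prime_gt1 // addn1 prednK // => le_p.
rewrite leqNgt; apply/negP => k0; move: le_p; rewrite leqNgt add1n ltnS.
by rewrite leq_pmull.
Qed.

(** Induction on the number of variables not yet removed. *)
Lemma frob_test_multiaffine (Y E : {set 'I_n}) f w : Y \subset E ->
  multiaffine f ->
  eliminable Y f -> f != 0 -> multiaffine w -> w != 0 ->
  (forall i, i \in E -> degv i w = 0%N) -> frob_test p 0 f w.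
Proof.
have [N] := ubnP #|~: E|; elim: N => // N IH in E f w *.
rewrite ltnS => cE YE mf ef f0 mw w0 Ew.
have [ET|ET] := eqVneq E [set: 'I_n]%SET.
  have wc : w = (w@_0)%:MP by apply: degv_all0 => i; apply: Ew; rewrite ET inE.
  by rewrite wc; apply: frob_test_const; move: w0; rewrite {1}wc mpolyC_eq0.
have [z zE Hz] := ef E YE ET.
suff [u [w'0 dz]] : exists u, frob_coord p u (f ^+ p.-1 * w) != 0 /\
    degv z (frob_coord p u (f ^+ p.-1 * w)) = 0%N.
  have dw i : (degv i w <= p)%N by apply: leq_trans (mw i) (prime_gt0 _).
  apply: (@frob_test_leq _ _ _ 0 (1 + 0)) => //.
  apply: (frob_test_step (charL := charL) (u := u)); rewrite expn1.
  apply: (IH (z |: E)) => //.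
  - apply: leq_trans cE; apply: proper_card; apply/properP; split.
      by rewrite finset.setCS finset.subsetUr.
    by exists z; rewrite !inE ?eqxx.
  - exact: fintype.subset_trans YE (finset.subsetUr _ _).
  - exact: multiaffine_map.
  - exact: eliminable_map.
  - by rewrite map_mpoly_eq0.
  - by move=> i; case: (degv_frob_coord_power u p_gt0 mf (dw i)).
  move=> i; rewrite !inE => /orP[/eqP->//|/Ew].
  by case: (degv_frob_coord_power u p_gt0 mf (dw i)).
case: Hz => [dz|[y yE D]]; last exact: frob_coord_eliminate (Ew _ yE) D.
have : f ^+ p.-1 * w != 0 by rewrite mulf_neq0 // expf_neq0.
rewrite -msupp_eq0; case Es: (msupp _) => [//|u s] _.
have us : u \in msupp (f ^+ p.-1 * w) by rewrite Es mem_head.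
exists u; split; first exact: frob_coord_neq0.
apply/eqP; rewrite -leqn0.
have /(degv_frob_coord_le p_gt0 u) /leq_trans -> // :
    (degv z (f ^+ p.-1 * w) <= 1)%N.
  apply: leq_trans (degvM_le _ _ _) _; rewrite -[1%N]add0n leq_add //.
  by apply: leq_trans (degvX_le _ _ _) _; rewrite dz muln0.
by rewrite divn_small ?prime_gt1.
Qed.

(** One step with [q] exceeding all degrees of [w] brings [w] to degree at
    most one in each variable without introducing variables of [Y], and
    makes the exponent as large as wished. *)
Lemma frob_test_free (Y : {set 'I_n}) f w : multiaffine f -> eliminable Y f ->
  f != 0 -> w != 0 -> (forall i, i \in Y -> degv i w = 0%N) ->
  forall e0, frob_test p e0 f w.
Proof.
move=> mf ef f0 w0 Yw e0; pose d := \max_i degv i w; pose e := maxn e0 d.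
have dw i : (degv i w <= p ^ e)%N.
  apply: leq_trans (leq_bigmax i) (leq_trans (leq_maxr e0 d) _).
  exact/ltnW/ltn_expl/prime_gt1.
have q0 := pexpn_gt0 charL e.
have : f ^+ (p ^ e).-1 * w != 0 by rewrite mulf_neq0 // expf_neq0.
rewrite -msupp_eq0; case Es: (msupp _) => [//|u s] _.
have us : u \in msupp (f ^+ (p ^ e).-1 * w) by rewrite Es mem_head.
apply: (@frob_test_leq _ _ _ e0 (e + 0)); first by rewrite addn0 leq_maxl.
apply: (frob_test_step (charL := charL) (u := u)).
apply: (frob_test_multiaffine (subxx Y)).
- exact: multiaffine_map.
- exact: eliminable_map.
- by rewrite map_mpoly_eq0.
- by move=> i; case: (degv_frob_coord_power u q0 mf (dw i)).
- exact: frob_coord_neq0.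
by move=> i /Yw; case: (degv_frob_coord_power u q0 mf (dw i)).
Qed.

End Elimination.

(** * Irreducible polynomials of degree at most one in each variable *)

Lemma rank_one_exchange (A : comNzRingType) (a b c d x y x' y' : A) :
  a * d - b * c = 0 ->
  (a + x * b + y * (c + x * d)) * (a + x' * b + y' * (c + x' * d)) =
  (a + x' * b + y * (c + x' * d)) * (a + x * b + y' * (c + x * d)).
Proof.
move=> D; apply/eqP; rewrite -subr_eq0; apply/eqP.
transitivity ((a * d - b * c) * ((x - x') * (y - y'))); first by ring.
by rewrite D mul0r.
Qed.

Section PartialEvaluation.
Variables (n : nat) (R : comNzRingType) (e : 'I_n -> R).
Implicit Types (S T : seq 'I_n) (f g : {mpoly R[n]}) (i : 'I_n).

Definition peval_var S i : {mpoly R[n]} := if i \in S then (e i)%:MP else 'X_i.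

Fact peval_key : unit. Proof. by []. Qed.

Definition peval S f : {mpoly R[n]} :=
  locked_with peval_key (mmap (@mpolyC n R) (peval_var S)) f.

Fact peval_is_zmod_morphism S : zmod_morphism (peval S).
Proof. by move=> f g; rewrite /peval unlock raddfB. Qed.

Fact peval_is_monoid_morphism S : monoid_morphism (peval S).
Proof. by split=> [|f g]; rewrite /peval unlock ?rmorph1 // rmorphM. Qed.

HB.instance Definition _ S := GRing.isZmodMorphism.Build {mpoly R[n]} {mpoly
  R[n]}
  (peval S) (peval_is_zmod_morphism S).
HB.instance Definition _ S := GRing.isMonoidMorphism.Build {mpoly R[n]} {mpoly
  R[n]}
  (peval S) (peval_is_monoid_morphism S).

Lemma pevalC S c : peval S c%:MP = c%:MP.
Proof. by rewrite /peval unlock /= mmapC. Qed.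

Lemma pevalXU S i : peval S 'X_i = peval_var S i.
Proof. by rewrite /peval unlock /= mmapX mmap1U. Qed.

Lemma pevalD S f g : peval S (f + g) = peval S f + peval S g.
Proof. exact: rmorphD. Qed.

Lemma pevalM S f g : peval S (f * g) = peval S f * peval S g.
Proof. exact: rmorphM. Qed.

Definition pevalE := (pevalC, pevalXU, pevalD, pevalM).

Lemma eq_peval S T f : S =i T -> peval S f = peval T f.
Proof.
move=> eST; apply: (mpoly_rmorph_eq (f := peval S) (g := peval T)) => [c|i] /=.
  by rewrite !pevalC.
by rewrite !pevalXU /peval_var eST.
Qed.

Lemma peval_nil f : peval [::] f = f.
Proof.
apply: (mpoly_rmorph_eq (f := peval [::]) (g := idfun)) => [c|i] /=.
  by rewrite pevalC.
by rewrite pevalXU.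
Qed.

Lemma peval_cat S T f : peval S (peval T f) = peval (S ++ T) f.
Proof.
apply: (mpoly_rmorph_eq (f := peval S \o peval T) (g := peval (S ++ T))) =>
  [c|i] /=.
  by rewrite !pevalC.
rewrite !pevalXU /peval_var mem_cat.
by case: (i \in T); rewrite ?orbT ?pevalC // pevalXU orbF.
Qed.

Lemma peval1E i f : peval [:: i] f = (uni i f).[(e i)%:MP].
Proof.
apply: (mpoly_rmorph_eq (f := peval [:: i])
          (g := horner_eval (e i)%:MP \o uni i)) => [c|j] /=.
  by rewrite pevalC uniC /horner_eval hornerC.
rewrite pevalXU uniXU /uni_var /peval_var /horner_eval inE.
by case: eqP => [->|_]; rewrite ?hornerX ?hornerC.
Qed.

Lemma peval1_free i f : degv i f = 0%N -> peval [:: i] f = f.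
Proof. by move=> d0; rewrite peval1E (degv0_uni d0) hornerC. Qed.

Lemma degv_peval S i f : i \in S -> degv i (peval S f) = 0%N.
Proof.
move=> iS; apply: (uni_degv0 (g := peval S f)).
apply: (mpoly_rmorph_eq (f := uni i \o peval S) (g := polyC \o peval S)) =>
  [c|j] /=.
  by rewrite pevalC uniC.
rewrite pevalXU /peval_var; case: ifP => jS; first by rewrite uniC.
by rewrite uniXU /uni_var; case: eqP jS => // ->; rewrite iS.
Qed.

Lemma meval_peval S f : (peval S f).@[e] = f.@[e].
Proof.
apply: (mpoly_rmorph_eq (f := meval e \o peval S) (g := meval e)) => [c|i] /=.
  by rewrite pevalC.
by rewrite pevalXU /peval_var; case: ifP; rewrite ?mevalC ?mevalXU.
Qed.

Lemma peval_full S f : (forall i, i \in S) -> peval S f = (f.@[e])%:MP.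
Proof.
move=> Sall.
apply: (mpoly_rmorph_eq (f := peval S) (g := @mpolyC n R \o meval e)) =>
  [c|i] /=.
  by rewrite pevalC mevalC.
by rewrite pevalXU /peval_var Sall mevalXU.
Qed.

(** A polynomial of rank one in two variables is a product of functions of
    each of them, up to factors in the other variables. *)
Lemma peval_exchange u v f : u != v -> multiaffine f -> coefv_det u v f = 0 ->
  f * peval [:: u; v] f = peval [:: u] f * peval [:: v] f.
Proof.
move=> uv mf D.
pose a := coefv u 0 (coefv v 0 f); pose b := coefv u 1 (coefv v 0 f).
pose c := coefv u 0 (coefv v 1 f); pose d := coefv u 1 (coefv v 1 f).
have du k : (degv u (coefv v k f) <= 1)%N :=
  leq_trans (degv_coefv_le _ _ _ _) (mf u).
have fE : f = a + 'X_u * b + 'X_v * (c + 'X_u * d).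
  by rewrite {1}(degv1E (mf v)) {1}(degv1E (du 0%N)) {1}(degv1E (du 1%N)).
have uF k l : peval [:: u] (coefv u k (coefv v l f)) = coefv u k (coefv v l f).
  by rewrite peval1_free ?degv_coefv_same.
have vF k l : peval [:: v] (coefv u k (coefv v l f)) = coefv u k (coefv v l f).
  rewrite peval1_free //; apply/eqP; rewrite -leqn0.
  by rewrite -(degv_coefv_same v l f) degv_coefv_le.
have Eu : peval [:: u] f = a + (e u)%:MP * b + 'X_v * (c + (e u)%:MP * d).
  rewrite {1}fE !pevalE /peval_var !inE eqxx eq_sym (negPf uv).
  by rewrite /a /b /c /d !uF.
have Ev : peval [:: v] f = a + 'X_u * b + (e v)%:MP * (c + 'X_u * d).
  rewrite {1}fE !pevalE /peval_var !inE eqxx (negPf uv).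
  by rewrite /a /b /c /d !vF.
have Euv : peval [:: u; v] f =
    a + (e u)%:MP * b + (e v)%:MP * (c + (e u)%:MP * d).
  rewrite -(peval_cat [:: u] [:: v]) Ev !pevalE /peval_var !inE eqxx.
  by rewrite /a /b /c /d !uF.
by rewrite Euv Eu Ev {1}fE rank_one_exchange.
Qed.

End PartialEvaluation.

(** The coefficient ring may be finite, but a point with coordinates [0] and
    [1] is enough: at the indicator of the support of a monomial of minimal
    degree, that monomial is the only one of [f] with nonzero value. *)
Lemma multiaffine_nonvanishing n (R : comNzRingType) (f : {mpoly R[n]}) :
  multiaffine f -> f != 0 -> exists e, f.@[e] != 0.
Proof.
move=> mf f0; pose m0 := mlast f; exists (fun i => (m0 i)%:R).
have m0f := mlast_supp f0.
have le1 m i : m \in msupp f -> (m i <= 1)%N by have /degv_leP := mf i; apply.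
rewrite mevalE (bigD1_seq m0) ?msupp_uniq //= [X in _ + X]big_seq_cond [X in _
  + X]big1.
  rewrite addr0 big1 ?mulr1 -?mcoeff_msupp // => i _.
  by have := le1 _ i m0f; case: (m0 i) => [|[|]] //; rewrite expr1n.
move=> m /andP[mf' nm]; have [i m0i mi] : exists2 i, m0 i = 0%N & m i != 0%N.
  apply: contrapT => none; move/negP: nm; apply; apply/eqP.
  have le_m : (m <= m0)%MM.
    apply/mnm_lepP => i; case mi: (m i) => [//|k]; rewrite -mi.
    apply: leq_trans (le1 _ i mf') _; rewrite lt0n; apply/eqP => m0i.
    by apply: none; exists i => //; rewrite mi.
  have := lemc_mdeg (mlast_lemc mf'); rewrite -/m0 -{1}(submK le_m) mdegD.
  rewrite -{2}[mdeg m]add0n leq_add2r leqn0 mdeg_eq0 => /eqP e0.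
  by rewrite -(submK le_m) e0 add0m.
by rewrite (bigD1 i) //= m0i expr0n (negPf mi) mul0r mulr0.
Qed.

(** One step of the propagation of the exchange relation from single
    variables to sets of variables. *)
Lemma exchange_cancel (A : idomainType) (s f x y z w : A) : s != 0 ->
  s * x = y * z -> f * z = s * w -> f * x = y * w.
Proof.
move=> s0 e1 e2; apply: (mulfI s0); transitivity (f * (s * x)); first by ring.
rewrite e1; transitivity (y * (f * z)); first by ring.
by rewrite e2; ring.
Qed.

Section Connectivity.
Variables (n : nat) (K : fieldType).
Implicit Types (f : {mpoly K[n]}) (E : {set 'I_n}).

(** The exchange relation is extended from one variable on each side to all
    the variables of [E] and of its complement. The cancellations are
    legitimate since [f] does not vanish at [e], so that no partial
    specialization of [f] at [e] is zero. *)
Lemma peval_product (e : 'I_n -> K) E f : multiaffine f -> f.@[e] != 0 ->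
  (forall u v, u \in E -> v \notin E -> coefv_det u v f = 0) ->
  f.@[e] *: f = peval e (enum E) f * peval e (enum (~: E)) f.
Proof.
move=> mf fe0 D.
have nz S : peval e S f != 0.
  by apply: contra_neq fe0 => f0; rewrite -(meval_peval e S) f0 meval0.
have swap u v S : u \in E -> v \notin E ->
    peval e S f * peval e (u :: v :: S) f = peval e (u :: S) f * peval e (v ::
      S) f.
  move=> uE vE; have uv : u != v by apply: contraNneq vE => <-.
  have H : peval e S f * peval e (S ++ [:: u; v]) f =
           peval e (S ++ [:: u]) f * peval e (S ++ [:: v]) f.
    by rewrite -!peval_cat -!pevalM (peval_exchange e uv mf (D u v uE vE)).
  have perm T : peval e (S ++ T) f = peval e (T ++ S) f.
    by apply: eq_peval => i; rewrite !mem_cat orbC.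
  by rewrite !perm in H.
have claim2 S v : {subset S <= E} -> v \notin E ->
    f * peval e (v :: S) f = peval e S f * peval e [:: v] f.
  move=> SE vE; elim: S SE => [|u S IH] SE; first by rewrite peval_nil.
  have uE := SE u (mem_head _ _).
  have {}IH := IH (fun i iS => SE i (mem_behead (s := u :: S) iS)).
  rewrite (@eq_peval _ _ e (v :: u :: S) (u :: v :: S)); last first.
    by move=> i; rewrite !inE orbCA.
  exact: exchange_cancel (nz S) (swap u v S uE vE) IH.
have claim3 T : (forall v, v \in T -> v \notin E) ->
    f * peval e (T ++ enum E) f = peval e (enum E) f * peval e T f.
  elim: T => [|v T IH] TE; first by rewrite peval_nil mulrC.
  have vE := TE v (mem_head _ _).
  have {}IH := IH (fun i iT => TE i (mem_behead (s := v :: T) iT)).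
  have EE : {subset enum E <= E} by move=> i; rewrite mem_enum.
  have H : peval e T f * peval e (T ++ v :: enum E) f =
           peval e (T ++ enum E) f * peval e (T ++ [:: v]) f.
    by rewrite -!peval_cat -!pevalM (claim2 _ _ EE vE).
  rewrite [peval e (enum E) f * _]mulrC in IH; rewrite [RHS]mulrC.
  apply: exchange_cancel (nz T) _ IH.
  rewrite (@eq_peval _ _ e ((v :: T) ++ enum E) (T ++ v :: enum E)); last first.
    by move=> i; rewrite /= !(inE, mem_cat) orbCA.
  rewrite H (@eq_peval _ _ e (T ++ [:: v]) (v :: T)); first exact: mulrC.
  by move=> i; rewrite !(inE, mem_cat) orbC.
rewrite -claim3 => [|v]; last by rewrite mem_enum inE.
rewrite [peval e (_ ++ _) f]peval_full -?mul_mpolyC 1?mulrC // => i.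
by rewrite mem_cat !mem_enum inE orNb.
Qed.

(** Otherwise [f] is a constant multiple of the product given by
    [peval_product], of which neither factor is constant: one misses the
    variable ['X_y] of [f], the other the variable ['X_z]. *)
Lemma irreducible_coefv_det E f y z : irreducible_element f -> multiaffine f ->
  y \in E -> degv y f != 0%N -> z \notin E -> degv z f != 0%N ->
  exists u v, [/\ u \in E, v \notin E & coefv_det u v f != 0].
Proof.
move=> [f0 fU firr] mf yE dy zE dz; apply: contrapT => none.
have [e fe0] := multiaffine_nonvanishing mf f0.
have D u v : u \in E -> v \notin E -> coefv_det u v f = 0.
  move=> uE vE; apply/eqP/negPn/negP => d; apply: none; exists u, v; split=> //.
have fE := peval_product mf fe0 D.
have {}fE : f = peval e (enum E) f * ((f.@[e])^-1 *: peval e (enum (~: E)) f).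
  by rewrite -scalerAr -fE scalerA mulVf // scale1r.
have dC i c (g : {mpoly K[n]}) : degv i g = 0%N -> degv i (c *: g) = 0%N.
  move=> dg; apply/eqP; rewrite -leqn0 -mul_mpolyC.
  by apply: leq_trans (degvM_le _ _ _) _; rewrite dg degvC.
have unitC (g : {mpoly K[n]}) : g \is a GRing.unit -> g = (g@_0)%:MP.
  by case/andP => /eqP.
case: (firr _ _ fE) => /unitC gc.
  move: dz; rewrite fE gc mul_mpolyC dC ?eqxx // dC //.
  by apply: degv_peval; rewrite mem_enum inE.
move: dy; rewrite fE gc mulrC mul_mpolyC dC ?eqxx //.
by apply: degv_peval; rewrite mem_enum.
Qed.

Variables (t : nat) (fs : 'I_t -> {mpoly K[n]}).
Hypothesis irr : forall i, irreducible_element (fs i).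
Let f := \prod_(i < t) fs i.
Hypothesis mf : multiaffine f.

Lemma irreducible_prod_neq0 : f != 0.
Proof. by apply/prodf_neq0 => i _; case: (irr i). Qed.

Lemma irreducible_var i : exists j, degv j (fs i) != 0%N.
Proof.
apply: contrapT => none; have [f0 /negP fU _] := irr i; apply: fU.
have fc : fs i = ((fs i)@_0)%:MP.
  apply: degv_all0 => j; apply/eqP/negPn/negP => dj; apply: none; exists j =>
    //.
rewrite fc; apply: (rmorph_unit (@mpolyC n K)); rewrite unitfE.
by move: f0; rewrite {1}fc mpolyC_eq0.
Qed.

Let cofactor i := \prod_(k < t | k != i) fs k.

Let fE i : f = fs i * cofactor i.
Proof. by rewrite /f (bigD1 i). Qed.

Let cofactor_neq0 i : cofactor i != 0.
Proof. by apply/prodf_neq0 => k _; case: (irr k). Qed.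

Let degvE i j : (degv j (fs i) + degv j (cofactor i))%N = degv j f.
Proof. by rewrite (fE i) degvM //; case: (irr i). Qed.

Lemma multiaffine_factor i : multiaffine (fs i).
Proof. by move=> j; apply: leq_trans (mf j); rewrite -(degvE i) leq_addr. Qed.

Lemma degv_cofactor i j : degv j (fs i) != 0%N -> degv j (cofactor i) = 0%N.
Proof.
have := mf j; rewrite -(degvE i); case: (degv j (fs i)) => // a.
by rewrite addSn ltnS leqn0 addn_eq0 => /andP[_ /eqP].
Qed.

Lemma degv_other_factor i k j : degv j (fs i) != 0%N -> k != i ->
  degv j (fs k) = 0%N.
Proof.
move=> /degv_cofactor dj ki; apply/eqP;
  rewrite -leqn0 -dj /cofactor (bigD1 k) //=.
rewrite degvM ?leq_addr //; first by case: (irr k).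
by apply/prodf_neq0 => l _; case: (irr l).
Qed.

(** A variable outside [E] that occurs in the product occurs in exactly one
    factor, which has a variable in [E] as well; [irreducible_coefv_det]
    applies to this factor. The other factors involve none of the two
    variables found, and only multiply the determinant by the square of
    their product. *)
Lemma irreducible_prod_eliminable (y : 'I_t -> 'I_n) :
  (forall i, degv (y i) (fs i) != 0%N) -> eliminable [set y i | i : 'I_t] f.
Proof.
move=> dy E YE ET; have [z zE] : exists z, z \notin E.
  apply: contrapT => none; move: ET => /negP; apply; apply/eqP/setP => i.
  by rewrite inE; apply/negPn/negP => iE; apply: none; exists i.
have [d0|dz] := eqVneq (degv z f) 0%N; first by exists z => //; left.
have [i dzi] : exists i, degv z (fs i) != 0%N.
  apply: contrapT => none; move: dz => /negP; apply; rewrite -leqn0 /f.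
  elim/big_rec: _ => [|i g _ dg]; first by rewrite -mpolyC1 degvC.
  apply: leq_trans (degvM_le _ _ _) _; rewrite -[0%N]addn0 leq_add //.
  by rewrite leqn0; apply/negPn/negP => di; apply: none; exists i.
have yE : y i \in E by apply: (fintype.subsetP YE); apply: imset_f.
have [u [v [uE vE D]]] :=
  irreducible_coefv_det (irr i) (@multiaffine_factor i) yE (dy i) zE dzi.
exists v => //; right; exists u => //.
have du : degv u (fs i) != 0%N.
  apply: contra_neq D => du; have cu k : coefv u 1 (coefv v k (fs i)) = 0.
    by apply: coefv_gt; rewrite ltnS -du degv_coefv_le.
  by rewrite /coefv_det !cu mulr0 mul0r subrr.
have dv : degv v (fs i) != 0%N.
  apply: contra_neq D => dv; have cv : coefv v 1 (fs i) = 0 by apply: coefv_gt;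
    rewrite dv.
  by rewrite /coefv_det cv /coefv !raddf0 !coef0 !mulr0 subrr.
have -> : coefv_det u v f = coefv_det u v (fs i) * cofactor i ^+ 2.
  by rewrite (fE i) /coefv_det !coefvM_free ?degv_cofactor //; ring.
by rewrite mulf_neq0 // expf_neq0.
Qed.

End Connectivity.

(** * Hilbert's basis theorem *)

Section Dickson.

(** Beyond any index the sequence attains a minimum over the remaining
    indices; choose such indices successively. *)
Lemma nat_nondecreasing_subseq (u : nat -> nat) :
  exists2 s : nat -> nat, (forall i, (s i < s i.+1)%N) &
    forall i, (u (s i) <= u (s i.+1))%N.
Proof.
have step a : exists b, (a <= b)%N /\ forall c, (b <= c)%N -> (u b <= u c)%N.
  have [N] := ubnP (u a); elim: N => // N IH in a *; rewrite ltnS => le_uaN.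
  have [H|] := pselect (forall c, (a <= c)%N -> (u a <= u c)%N);
    first by exists a.
  move=> /existsNP[c /not_implyP[le_ac /negP]]; rewrite -ltnNge => lt_uca.
  have [b [le_cb Hb]] := IH c (leq_trans lt_uca le_uaN).
  by exists b; split=> //; apply: leq_trans le_cb.
have [g Hg] := choice step.
pose s := fix s i := if i is j.+1 then g (s j).+1 else g 0%N.
exists s => i /=; first by have [] := Hg (s i).+1.
(* Each s i is an index g a from which u stays above its value, and s i.+1 is
   a later index. *)
have [a ->] : exists a, s i = g a by case: i => [|i]; eexists.
have [_ H] := Hg a; have [le _] := Hg (g a).+1.
by apply/H/(leq_trans (leqnSn _))/le.
Qed.

Lemma dickson n (u : nat -> 'X_{1..n}) :
  exists i j, (i < j)%N /\ (u i <= u j)%MM.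
Proof.
suff [s smono us] : exists2 s : nat -> nat, (forall i, (s i < s i.+1)%N) &
    forall k, k \in enum 'I_n -> forall i, (u (s i) k <= u (s i.+1) k)%N.
  exists (s 0%N), (s 1%N); split=> //; apply/mnm_lepP => k.
  by apply: us; rewrite mem_enum.
elim: (enum 'I_n) => [|k ks [s smono us]]; first by exists id.
have [s' s'mono us'] := nat_nondecreasing_subseq (fun i => u (s i) k).
have mono (v : nat -> nat) (r : rel nat) : reflexive r -> transitive r ->
    (forall i, r (v i) (v i.+1)) -> forall i j, (i <= j)%N -> r (v i) (v j).
  move=> rr rt rS i j /subnKC <-; elim: (j - i)%N => [|d IH];
    first by rewrite addn0.
  by rewrite addnS; apply: rt (rS _).
exists (s \o s') => [i|l] /=.
  have lt : (s' i < s' i.+1)%N := s'mono i.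
  apply: leq_trans (smono _) _; apply: (mono s leq leqnn leq_trans) lt.
  by move=> j; apply: ltnW.
rewrite inE => /orP[/eqP-> //|lks] i.
apply: (mono (fun i => u (s i) l) leq leqnn leq_trans); last exact/ltnW.
exact: us.
Qed.

End Dickson.

Section HilbertBasis.
Import Order.TTheory.
Variables (n : nat) (L : fieldType).
Implicit Types (I : set {mpoly L[n]}) (f g : {mpoly L[n]}).

Lemma mlead_minimal (P : {mpoly L[n]} -> Prop) : (exists f, P f) ->
  exists2 f, P f & forall g, P g -> (mlead f <= mlead g)%O.
Proof.
move=> [f0 Pf0]; apply: contrapT => none.
have : forall m f, mlead f = m -> ~ P f.
  apply: ltmwf => m IH f fm Pf; apply: none; exists f => // g Pg.
  rewrite leNgt; apply/negP => lt.
  by apply: (IH (mlead g)) Pg => //; rewrite -fm.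
by move=> /(_ _ f0 erefl); apply.
Qed.

Lemma mlead_reduce f g : g != 0 -> f != 0 -> (mlead g <= mlead f)%MM ->
  exists h, f - h * g = 0 \/ (mlead (f - h * g) < mlead f)%O.
Proof.
move=> g0 f0 le_gf.
pose h : {mpoly L[n]} := (mleadc f / mleadc g) *: 'X_[mlead f - mlead g].
have gc0 : mleadc g != 0 by rewrite mleadc_eq0.
have fc0 : mleadc f != 0 by rewrite mleadc_eq0.
have h0 : h != 0 by rewrite scaler_eq0 negb_or mulf_neq0 ?invr_eq0 //=
  -msupp_eq0 msuppX.
have hl : mlead (h * g) = mlead f.
  rewrite mleadM // mleadZ ?mulf_neq0 ?invr_eq0 // mleadXm submK //.
have hc : (h * g)@_(mlead f) = mleadc f.
  rewrite -{1}hl mleadM // mleadcM mleadcZE mleadXm mcoeffX eqxx mulr1 divfK //.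
exists h; have [->|d0] := eqVneq (f - h * g) 0; [by left|right].
have le : (mlead (f - h * g) <= mlead f)%O.
  by apply: le_trans (mleadB_le _ _) _; rewrite hl joinxx.
rewrite lt_neqAle le andbT; apply: contra_neq d0 => e.
by apply/eqP; rewrite -mleadc_eq0 e mcoeffB hc subrr.
Qed.

(** If [I] is not finitely generated, choose successively elements of [I]
    outside the ideal of the previous ones, with minimal leading monomial.
    By Dickson's lemma one leading monomial divides a later one, and the
    reduction of the later element by the earlier one contradicts
    minimality. *)
Lemma hilbert_basis : noetherian {mpoly L[n]}.
Proof.
move=> I II; apply: contrapT => none.
have [I0 ID IM] := II.
pose good (s : seq {mpoly L[n]}) f := [/\ I f, ~ ideal_gen [set` s] f &
  forall g, I g -> ~ ideal_gen [set` s] g -> (mlead f <= mlead g)%O].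
have ex s : exists f, {subset s <= I} -> good s f.
  have [sI|] := pselect {subset s <= I}; last by move=> H; exists 0.
  have [] := @mlead_minimal (fun f => I f /\ ~ ideal_gen [set` s] f).
    apply: contrapT => H; apply: none; exists s; apply/seteqP; split=> f.
      by move=> If; apply: contrapT => nf; apply: H; exists f.
    by apply: ideal_gen_min => // x /sI; rewrite inE.
  move=> f [If nf] Hf; exists f => _; split=> // g Ig ng; exact: Hf.
have [next Hnext] := choice ex.
pose s := fix s k := if k is j.+1 then next (s j) :: s j else [::].
have sI k : {subset s k <= I}.
  elim: k => [//|k IH] f /=; rewrite inE => /orP[/eqP->|fs].
    by have [If _ _] := Hnext _ IH.
  by have := IH _ fs; rewrite inE.
pose u k := next (s k); have Hu k := Hnext _ (sI k).
have us i j : (i < j)%N -> u i \in s j.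
  elim: j => // j IH; rewrite ltnS leq_eqVlt /= inE.
  by case/orP => [/eqP->|/IH ->]; rewrite ?eqxx ?orbT.
have u0 k : u k != 0.
  apply/eqP => e; have [_ + _] := Hu k; rewrite -/(u k) e; apply.
  by have [] := ideal_gen_ideal [set` s k].
have [i [j [lt_ij le_ij]]] := dickson (fun k => mlead (u k)).
have [Iuj nuj minuj] := Hu j; have ui_s := us i j lt_ij.
have [h Hh] := mlead_reduce (u0 i) (u0 j) le_ij.
have hg : ideal_gen [set` s j] (h * u i).
  have [_ _ M] := ideal_gen_ideal [set` s j].
  by apply: M; apply: sub_ideal_gen.
have nd : ~ ideal_gen [set` s j] (u j - h * u i).
  move=> d; apply: nuj; rewrite -/(u j) -(subrK (h * u i) (u j)).
  by have [_ D _] := ideal_gen_ideal [set` s j]; apply: D.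
case: Hh => [d0|lt].
  by apply: nd; rewrite d0; have [] := ideal_gen_ideal [set` s j].
have Id : I (u j - h * u i).
  apply: idealB => //; apply: IM; have [Iui _ _] := Hu i; exact: Iui.
have := minuj _ Id nd; rewrite -/(u j) leNgt lt //.
Qed.

End HilbertBasis.

(** * Tight closure in a quotient of a polynomial ring *)

Section Clearing.
Variables (n : nat) (L : fieldType) (t : nat) (gs : 'I_t -> {mpoly L[n]}).
Variable ys : 'I_t -> 'I_n.
Notation S := {mpoly L[n]}.
Implicit Types (u c : S) (i k : 'I_t).

Hypothesis gs_multiaffine : forall i, multiaffine (gs i).
Hypothesis gs_lead : forall i, coefv (ys i) 1 (gs i) != 0.
Hypothesis gs_other : forall i k, k != i -> degv (ys k) (gs i) = 0%N.

Let g i := coefv (ys i) 1 (gs i).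
Let h i := coefv (ys i) 0 (gs i).

Definition ys_free u := forall i, degv (ys i) u = 0%N.

Definition lead_prod := \prod_i g i.

Lemma ys_inj : injective ys.
Proof.
move=> i k e; apply/eqP/negPn/negP => ik; have := gs_lead i.
by rewrite coefv_gt ?eqxx // e (gs_other (i := i)) // eq_sym.
Qed.

Lemma coefv_ys_free i d : ys_free (coefv (ys i) d (gs i)).
Proof.
move=> k; have [->|ki] := eqVneq k i; first exact: degv_coefv_same.
by apply/eqP; rewrite -leqn0 -(gs_other ki) degv_coefv_le.
Qed.

Lemma gsE i : gs i = h i + 'X_(ys i) * g i.
Proof. exact/degv1E/gs_multiaffine. Qed.

Lemma ys_freeD u v : ys_free u -> ys_free v -> ys_free (u + v).
Proof.
by move=> uf vf i; apply/eqP; rewrite -leqn0 degvD_le ?uf ?vf.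
Qed.

Lemma ys_freeM u v : ys_free u -> ys_free v -> ys_free (u * v).
Proof.
move=> uf vf i; apply/eqP; rewrite -leqn0.
by apply: leq_trans (degvM_le _ _ _) _; rewrite uf vf.
Qed.

Lemma ys_freeC (a : L) : ys_free a%:MP.
Proof. by move=> i; rewrite degvC. Qed.

Lemma ys_free_prod (P : pred 'I_t) : ys_free (\prod_(i | P i) g i).
Proof.
elim/big_rec: _ => [|i u _ uf]; first by rewrite -mpolyC1; apply: ys_freeC.
exact: ys_freeM (@coefv_ys_free i 1) uf.
Qed.

Lemma ys_freeX u N : ys_free u -> ys_free (u ^+ N).
Proof.
move=> uf; elim: N => [|N IH]; first by rewrite expr0 -mpolyC1; apply: ys_freeC.
by rewrite exprS; apply: ys_freeM.
Qed.

Lemma lead_prod_neq0 : lead_prod != 0.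
Proof. by apply/prodf_neq0 => i _; apply: gs_lead. Qed.

(** The relations [gs i = h i + 'X_(ys i) * g i] can be solved for the
    variables [ys i] in the fraction field, as [h i] and [g i] involve none
    of these variables. *)
Lemma generic_zero : exists ev : {rmorphism S -> {fraction S}},
  (forall i, ev (gs i) = 0) /\ (forall u, ys_free u -> ev u = tofrac u).
Proof.
pose v j : {fraction S} :=
  if [pick i | ys i == j] is Some i then - tofrac (h i) / tofrac (g i) else
    tofrac 'X_j.
pose ev : {rmorphism S -> {fraction S}} := mmap (@tofrac S \o @mpolyC n L) v.
have evX j : ev 'X_j = v j by rewrite /ev /= mmapX mmap1U.
have evC (a : L) : ev a%:MP = tofrac a%:MP by rewrite /ev /= mmapC.
have ev_free u : ys_free u -> ev u = tofrac u.
  move=> uf; rewrite (mpolyE u) !rmorph_sum /= !big_seq; apply: eq_bigr => m mu.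
  rewrite -mul_mpolyC [LHS](rmorphM ev) [RHS](rmorphM (@tofrac S)) evC.
  congr (_ * _); rewrite mpolyXE_id [LHS](rmorph_prod ev) rmorph_prod.
  apply: eq_bigr => j _; rewrite [LHS](rmorphXn ev) rmorphXn evX /v.
  case: pickP => [i /eqP ij|//].
  have /degv_leP/(_ _ mu) : (degv (ys i) u <= 0)%N by rewrite uf.
  by rewrite leqn0 ij => /eqP->.
exists ev; split=> // i; rewrite gsE [LHS](rmorphD ev) [X in _ + X](rmorphM ev).
rewrite (ev_free (h i)) ?(ev_free (g i)); try exact: coefv_ys_free.
rewrite evX /v; case: pickP => [k /eqP /ys_inj ->|/(_ i)]; last by rewrite eqxx.
by rewrite divfK ?subrr // tofrac_eq0 gs_lead.
Qed.

(** The polynomials with this property form a subring, and for a variable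
    ['X_(ys i)] the relation [gs i] expresses [g i * 'X_(ys i)] by a
    polynomial free of the variables [ys]. *)
Lemma clear_leads c : exists N c', ys_free c' /\
  ideal_gen (range gs) (lead_prod ^+ N * c - c').
Proof.
have [Q0 QD QM] := ideal_gen_ideal (range gs).
have Gf : ys_free lead_prod by apply: ys_free_prod.
move: c; apply: mpoly_gen_ind => [c|j|a b|a b].
- exists 0%N, c%:MP; split; first exact: ys_freeC.
  by rewrite expr0 mul1r subrr.
- have [[i <-]|none] := pselect (exists i, ys i = j); last first.
    exists 0%N, 'X_j; split; last by rewrite expr0 mul1r subrr.
    move=> i; apply/eqP; rewrite -leqn0; apply: leq_trans (degvXU _ _ _) _.
    by case: eqP => // e; case: none; exists i.
  pose G' := \prod_(k | k != i) g k.
  exists 1%N, (- (G' * h i)); split.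
    rewrite -mulN1r -mpolyC1 -mpolyCN.
    apply: ys_freeM (ys_freeC _) (ys_freeM (ys_free_prod _) (@coefv_ys_free i
      0)).
  have -> : lead_prod ^+ 1 * 'X_(ys i) - - (G' * h i) = G' * gs i.
    rewrite gsE /lead_prod (bigD1 i) //= -/G'.
    ring.
  by apply: (QM); apply: sub_ideal_gen; exists i.
- move=> [N [a' [af Ha]]] [M [b' [bf Hb]]].
  exists (N + M)%N, (lead_prod ^+ M * a' + lead_prod ^+ N * b').
  split; first by apply: ys_freeD; apply: ys_freeM => //; apply: ys_freeX.
  rewrite exprD; set x := lead_prod ^+ N in Ha *; set y :=
    lead_prod ^+ M in Hb *.
  have -> : x * y * (a + b) - (y * a' + x * b') =
            y * (x * a - a') + x * (y * b - b') by ring.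
  by apply: QD; apply: QM.
move=> [N [a' [af Ha]]] [M [b' [bf Hb]]].
exists (N + M)%N, (a' * b'); split; first exact: ys_freeM.
rewrite exprD; set x := lead_prod ^+ N in Ha *; set y := lead_prod ^+ M in Hb *.
have -> : x * y * (a * b) - a' * b' =
          (y * b) * (x * a - a') + a' * (y * b - b') by ring.
by apply: QD; apply: QM.
Qed.

End Clearing.

Section Presentation.
Variables (p : nat) (L : fieldType) (charL : p \in [pchar L]) (n : nat).
Variables (t : nat) (gs : 'I_t -> {mpoly L[n]}) (ys : 'I_t -> 'I_n).
Notation S := {mpoly L[n]}.
Let F := \prod_(i < t) gs i.
Let Y := [set ys i | i : 'I_t].

Hypothesis gs_multiaffine : forall i, multiaffine (gs i).
Hypothesis gs_lead : forall i, coefv (ys i) 1 (gs i) != 0.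
Hypothesis gs_other : forall i k, k != i -> degv (ys k) (gs i) = 0%N.
Hypothesis F_multiaffine : multiaffine F.
Hypothesis F_neq0 : F != 0.
Hypothesis F_eliminable : eliminable Y F.

Variables (A : comPzRingType) (pi : {rmorphism S -> A}).
Hypothesis pi_surj : forall a, exists c, pi c = a.
Hypothesis pi_ker : forall c, pi c = 0 <-> ideal_gen (range gs) c.

Variable ev : {rmorphism S -> {fraction S}}.
Hypothesis ev_gs : forall i, ev (gs i) = 0.
Hypothesis ev_free : forall u, ys_free ys u -> ev u = tofrac u.

Lemma ev_ker c : pi c = 0 -> ev c = 0.
Proof.
move=> /pi_ker; move: c; apply: ideal_gen_min => [|_ [i _ <-]];
  last exact: ev_gs.
split=> [|a b a0 b0|a b b0]; first exact: rmorph0.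
  by rewrite rmorphD a0 b0 addr0.
by rewrite rmorphM b0 mulr0.
Qed.

Lemma ev_pi c d : pi c = pi d -> ev c = ev d.
Proof.
move=> e; apply/eqP; rewrite -subr_eq0 -rmorphB; apply/eqP/ev_ker.
by rewrite rmorphB e subrr.
Qed.

Definition ev_prime : set A := [set a | exists2 c, pi c = a & ev c = 0].

Lemma ev_prime_pi c : ev_prime (pi c) <-> ev c = 0.
Proof. by split=> [[d /ev_pi <-]//|]; exists c. Qed.

Lemma ev_prime_is_prime : is_prime ev_prime.
Proof.
split; first split.
- by rewrite -(rmorph0 pi); apply/ev_prime_pi; rewrite rmorph0.
- move=> _ _ [c <- c0] [d <- d0]; rewrite -rmorphD; apply/ev_prime_pi.
  by rewrite rmorphD c0 d0 addr0.
- move=> a _ [d <- d0]; have [c <-] := pi_surj a; rewrite -rmorphM.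
  by apply/ev_prime_pi; rewrite rmorphM d0 mulr0.
- rewrite -(rmorph1 pi) => /ev_prime_pi; rewrite rmorph1 => /eqP.
  by rewrite oner_eq0.
move=> a b; have [c <-] := pi_surj a; have [d <-] := pi_surj b.
rewrite -rmorphM => /ev_prime_pi /eqP; rewrite rmorphM mulf_eq0.
by case/orP => /eqP e; [left|right]; apply/ev_prime_pi.
Qed.

Lemma ev_lead_prod : ev (lead_prod gs ys) != 0.
Proof.
rewrite ev_free; last exact: ys_free_prod.
by rewrite tofrac_eq0 lead_prod_neq0.
Qed.

(** Substituting the generic zero in the relation of [clear_leads]
    identifies [ev c] with [c'] up to a nonzero factor. *)
Lemma clear_ev c : exists N c', [/\ ys_free ys c',
   ideal_gen (range gs) (lead_prod gs ys ^+ N * c - c') & ev c = 0 <-> c' = 0].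
Proof.
have [N [c' [c'f Hc]]] := clear_leads gs_multiaffine gs_other c.
exists N, c'; split=> //; have /pi_ker/ev_ker := Hc.
rewrite rmorphB rmorphM rmorphXn (ev_free c'f) => /subr0_eq e.
split=> [c0|c0].
  by move: e => /eqP; rewrite c0 mulr0 eq_sym tofrac_eq0 => /eqP.
move: e => /eqP; rewrite c0 tofrac0 mulf_eq0 expf_eq0.
by rewrite (negPf ev_lead_prod) andbF => /eqP.
Qed.

(** Every element of the kernel of the generic zero is annihilated in [A] by
    a power of the product of the leading coefficients, which is not in the
    kernel. *)
Lemma ev_prime_minimal : minimal_prime ev_prime.
Proof.
split; first exact: ev_prime_is_prime.
move=> P' P'prime sub; apply/seteqP; split=> // _ [c <- c0].
have [N [c' [_ Hc c'0]]] := clear_ev c.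
have : pi (lead_prod gs ys ^+ N * c) = 0.
  by apply/pi_ker; rewrite (c'0.1 c0) subr0 in Hc.
rewrite rmorphM rmorphXn => e.
have [[P'0 _ _] _ P'M] := P'prime.
have /P'M [/(prime_exp P'prime) /sub /ev_prime_pi|//] :
  P' (pi (lead_prod gs ys) ^+ N * pi c) by rewrite e.
by move=> G0; move: ev_lead_prod; rewrite G0 eqxx.
Qed.

Section TightlyClosed.
Variable (I : set A).
Hypothesis II : is_ideal I.

Let J : set S := [set c | I (pi c)].

Let J_ideal : is_ideal J.
Proof.
have [I0 ID IM] := II; split; rewrite /J /=; first by rewrite rmorph0.
  by move=> a b; rewrite rmorphD; apply: ID.
by move=> a b; rewrite rmorphM; apply: IM.
Qed.

(** Relations in [A] are lifted to [S] up to an element of the kernel of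
    [pi], which [kernel_colon] absorbs. *)
Lemma frobenius_power_lift q x : frobenius_power I q x ->
  exists2 y, frobenius_power J q y & pi y = x.
Proof.
have [J0 JD JM] := ideal_gen_ideal [set a ^+ q | a in J].
move: x; apply: ideal_gen_min => [|_ [a Ia <-]].
  split; first by exists 0 => //; apply: rmorph0.
    move=> _ _ [y Hy <-] [z Hz <-]; exists (y + z); last exact: rmorphD.
    exact: JD.
  move=> a _ [z Hz <-]; have [c <-] := pi_surj a.
  by exists (c * z); [apply: JM|rewrite rmorphM].
have [c e] := pi_surj a; exists (c ^+ q); last by rewrite rmorphXn e.
by apply: sub_ideal_gen; exists c => //; rewrite /J /= e.
Qed.

(** The product [F ^+ q.-1 * gs i] is a multiple of [gs i ^+ q], and [gs i]
    lies in [J]. *)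
Lemma kernel_colon q b : (0 < q)%N -> ideal_gen (range gs) b ->
  frobenius_power J q (F ^+ q.-1 * b).
Proof.
have [J0 JD JM] := ideal_gen_ideal [set a ^+ q | a in J].
move=> q0; move: b; apply: ideal_gen_min => [|_ [i _ <-]].
  split; first by rewrite mulr0.
    by move=> a b Ha Hb; rewrite mulrDr; apply: JD.
  by move=> a b Hb; rewrite mulrCA; apply: JM.
have -> : F ^+ q.-1 * gs i = (\prod_(k < t | k != i) gs k) ^+ q.-1 * gs i ^+ q.
  rewrite /F (bigD1 i) //= exprMn -mulrA mulrCA -exprSr prednK //.
apply: (JM); apply: sub_ideal_gen; exists (gs i) => //.
rewrite /J /=; have -> : pi (gs i) = 0 by apply/pi_ker; apply: sub_ideal_gen;
  exists i.
by have [] := II.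
Qed.

(** A multiplier [c] witnessing [r] in the tight closure avoids the minimal
    prime [ev_prime], so a multiple of it lifts, modulo the kernel of [pi],
    to a nonzero polynomial [c'] free of the variables [ys];
    [frob_test_free] applies to [c']. *)
Lemma ideal_tightly_closed : tightly_closed p I.
Proof.
apply/seteqP; split=> [r Ir|r].
  exists 1; first by move=> P [[_ P1 _] _].
  by exists 0%N => e _; rewrite mul1r; apply: sub_ideal_gen; exists r.
move=> [c cP [e0 H]]; have [d dc] := pi_surj c; have [s sr] := pi_surj r.
have [N [c' [c'f Hc c'0]]] := clear_ev d.
have c'N : c' != 0.
  apply/eqP => /c'0 /ev_prime_pi; rewrite dc; exact: cP ev_prime_minimal.
have Yc' i : i \in Y -> degv i c' = 0%N by move=> /imsetP[k _ ->].
have [e le_e test] :=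
  frob_test_free charL F_multiaffine F_eliminable F_neq0 c'N Yc' e0.
rewrite -sr; apply: (test J s J_ideal).
have q0 := pexpn_gt0 charL e; set q := (p ^ e)%N in q0 *.
have [y Jy ey] := frobenius_power_lift (H e le_e).
have [J0 JD JM] := ideal_gen_ideal [set a ^+ q | a in J].
set G := lead_prod gs ys ^+ N in Hc.
have Hy : ideal_gen (range gs) (d * s ^+ q - y).
  by apply/pi_ker; rewrite rmorphB rmorphM rmorphXn ey dc sr subrr.
have -> : F ^+ q.-1 * c' * s ^+ q = - s ^+ q * (F ^+ q.-1 * (G * d - c')) +
   (G * (F ^+ q.-1 * (d * s ^+ q - y)) + (F ^+ q.-1 * G) * y) by ring.
apply: (JD); first by apply: (JM); apply: kernel_colon.
by apply: (JD); apply: (JM) => //; apply: kernel_colon.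
Qed.

End TightlyClosed.

Lemma presented_noetherian : noetherian A.
Proof.
move=> I II; have [I0 ID IM] := II.
have JI : is_ideal [set c | I (pi c)].
  split=> [|a b|a b] /=; first by rewrite rmorph0.
    by rewrite rmorphD; apply: ID.
  by rewrite rmorphM; apply: IM.
have [s es] := hilbert_basis JI; exists (map pi s); apply/seteqP;
  split=> [a Ia|].
  have [c ec] := pi_surj a; have : [set c | I (pi c)] c by rewrite /= ec.
  have [M0 MD MM] := ideal_gen_ideal [set` map pi s].
  rewrite es -ec; move: c {ec}; apply: ideal_gen_min => [|c cs].
    split=> [|x y|x y] /=; first by rewrite rmorph0.
      by rewrite rmorphD; apply: MD.
    by rewrite rmorphM; apply: MM.
  by apply: sub_ideal_gen; apply: map_f.
apply: ideal_gen_min => // _ /mapP[c cs ->].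
suff : [set c | I (pi c)] c by [].
by rewrite es; apply: sub_ideal_gen.
Qed.

Lemma presented_has_char : has_char A p.
Proof.
move=> m; have charF : p \in [pchar {fraction S}].
  by rewrite (rmorph_pchar (@tofrac S)) // (mpoly_pchar charL).
have charS := mpoly_pchar charL n.
apply/eqP/idP => [m0|]; last rewrite (dvdn_pcharf charS) => /eqP m0.
  rewrite (dvdn_pcharf charF) -(rmorph_nat ev) ev_ker //.
  by rewrite rmorph_nat.
by rewrite -(rmorph_nat pi) m0 rmorph0.
Qed.

Lemma presented_F_rational : F_rational p A.
Proof.
split; [exact: presented_noetherian|exact: pcharf_prime charL|
        exact: presented_has_char|].
by move=> I [r -> _]; apply: ideal_tightly_closed; apply: ideal_gen_ideal.
Qed.

End Presentation.

(** * Base change of the quotient, and the theorem *)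

Section QuotientLift.
Variables (A T : comPzRingType) (X : set A) (f : {rmorphism A -> T}).
Hypothesis fX : forall x, X x -> f x = 0.

Lemma ring_quot_lift :
  exists h : {rmorphism ring_quot X -> T}, forall a, h (ring_quot_pi X a) = f a.
Proof.
have f0 a : ideal_gen X a -> f a = 0.
  move: a; apply: (@ideal_gen_min _ X [set a | f a = 0]) => //.
  split=> [|a b /= a0 b0|a b /= b0]; first exact: rmorph0.
    by rewrite rmorphD a0 b0 addr0.
  by rewrite rmorphM b0 mulr0.
pose h (x : ring_quot X) : T := f (repr x).
have hE a : h (ring_quot_pi X a) = f a.
  apply/eqP; rewrite -subr_eq0 -rmorphB; apply/eqP/f0/ring_quot_eqP.
  by rewrite [LHS]reprK.
have hB : zmod_morphism h.
  by elim/ring_quot_ind=> a; elim/ring_quot_ind=> b;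
    rewrite -rmorphB !hE rmorphB.
have hM : monoid_morphism h.
  split; first by rewrite -(rmorph1 (ring_quot_pi X)) hE rmorph1.
  by elim/ring_quot_ind=> a; elim/ring_quot_ind=> b;
    rewrite -rmorphM !hE rmorphM.
pose hz := GRing.isZmodMorphism.Build _ _ h hB.
pose hm := GRing.isMonoidMorphism.Build _ _ h hM.
by exists (HB.pack h hz hm : {rmorphism ring_quot X -> T}).
Qed.

End QuotientLift.

Section TensorPresentation.
Variables (K L : fieldType) (iota : {rmorphism K -> L}) (n t : nat).
Variable fs : 'I_t -> {mpoly K[n]}.
Let gs i := map_mpoly iota (fs i).
Notation A := (tensor (mpoly_quot (range fs)) iota).
Notation B := (ring_quot (range gs)).

(** The inverse of the presentation of the tensor product, which bounds the
    kernel of the latter. *)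
Lemma tensor_to_quotient : exists h : {rmorphism A -> B},
  (forall a, h (tensorl _ _ (ring_quot_pi (range fs) a)) =
             ring_quot_pi (range gs) (map_mpoly iota a)) /\
  (forall l, h (tensorr _ _ l) = ring_quot_pi (range gs) l%:MP).
Proof.
have kill x : range fs x -> (ring_quot_pi (range gs) \o map_mpoly iota) x = 0.
  move=> [i _ <-] /=; rewrite -(rmorph0 (ring_quot_pi (range gs))).
  by apply/ring_quot_eqP; rewrite subr0; apply: sub_ideal_gen; exists i.
have [f fE] := ring_quot_lift kill.
have compat k : f (mpoly_quot (range fs) k) =
    (ring_quot_pi (range gs) \o @mpolyC n L) (iota k).
  by rewrite /mpoly_quot /= fE /= map_mpolyC.
have [h [hl hr _]] := tensor_univ compat.
by exists h; split=> [a|l]; rewrite ?hl ?hr // fE.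
Qed.

Hypothesis gs_proper : ~ ideal_gen (range gs) 1.

(** The tensor product must first be known to be nonzero, which is read off
    its image in the quotient ring. *)
Lemma tensor_presentation : exists pi : {rmorphism {mpoly L[n]} -> A},
  (forall a, exists c, pi c = a) /\
  (forall c, pi c = 0 <-> ideal_gen (range gs) c).
Proof.
have [h [hl hr]] := tensor_to_quotient.
have A1 : (1 : A) != 0.
  apply/eqP => e; apply: gs_proper; rewrite -[1]subr0; apply/ring_quot_eqP.
  by rewrite !(rmorph1, rmorph0) -(rmorph1 h) e rmorph0.
(* Polynomial evaluation takes its values in a nonzero ring; A' is A with
   this additional structure. *)
pose A' : comNzRingType :=
  HB.pack A (GRing.PzSemiRing_isNonZero.Build A A1).
pose X i : A := tensorl (mpoly_quot (range fs)) iota (ring_quot_pi (range fs)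
  'X_i).
pose tr : {rmorphism L -> A'} := tensorr (mpoly_quot (range fs)) iota.
pose pi : {rmorphism {mpoly L[n]} -> A'} := mmap tr X.
have piC l : pi l%:MP = tensorr (mpoly_quot (range fs)) iota l by rewrite /pi
  /= mmapC.
have piX i : pi 'X_i = X i by rewrite /pi /= mmapX mmap1U.
pose piA : {rmorphism {mpoly L[n]} -> A} := pi.
have pil a : pi (map_mpoly iota a) = tensorl (mpoly_quot (range fs)) iota
  (ring_quot_pi (range fs) a).
  apply: (mpoly_rmorph_eq (f := piA \o map_mpoly iota)
    (g := tensorl (mpoly_quot (range fs)) iota \o ring_quot_pi (range fs))) =>
      [c|i] /=.
    by rewrite map_mpolyC [LHS]piC -tensorl_tensorr.
  by rewrite map_mpolyX [LHS]piX.
have hpi c : h (piA c) = ring_quot_pi (range gs) c.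
  apply: (mpoly_rmorph_eq (f := h \o piA) (g := ring_quot_pi (range gs))) =>
    [l|i] /=.
    by rewrite [piA _]piC hr.
  by rewrite [piA _]piX hl map_mpolyX.
exists piA; split=> [a|c].
  elim/tensor_ind: a => s; elim: s => [|[x l] s [c ec]].
    by exists 0; rewrite rmorph0.
  elim/ring_quot_ind: x => a; exists (map_mpoly iota a * l%:MP + c).
  rewrite rmorphD rmorphM ec [piA _]pil [piA _]piC /tensorl /tensorr pureM
    mulr1 mul1r.
  by rewrite [LHS]tensor_addE.
split=> [c0|].
  by rewrite -[c]subr0; apply/ring_quot_eqP; rewrite -hpi c0 !rmorph0.
move: c; apply: ideal_gen_min => [|_ [i _ <-]].
  split=> [|a b a0 b0|a b b0]; first exact: rmorph0.
    by rewrite rmorphD a0 b0 addr0.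
  by rewrite rmorphM b0 mulr0.
rewrite [LHS]pil; have -> : ring_quot_pi (range fs) (fs i) = 0;
  last exact: rmorph0.
rewrite -(rmorph0 (ring_quot_pi (range fs))); apply/ring_quot_eqP.
by rewrite subr0; apply: sub_ideal_gen; exists i.
Qed.

End TensorPresentation.

Theorem theorem2p14 (p : nat) (K : fieldType) (charK : p \in [pchar K])
  (n : nat) (f : {mpoly K[n]}) (sf : square_free_supported f)
  (t : nat) (fs : 'I_t -> {mpoly K[n]})
  (irr : forall i, irreducible_element (fs i)) (ff : f = \prod_(i < t) fs i) :
  geometrically_F_rational p (mpoly_quot (range fs)).
Proof.
move=> L iota; have charL : p \in [pchar L] by rewrite (rmorph_pchar iota).
have mf : multiaffine (\prod_(i < t) fs i).
  by rewrite -ff => i; apply/degv_leP => m mf; apply: sf.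
have [ys dy] := choice (irreducible_var irr).
pose gs i := map_mpoly iota (fs i).
have FE : \prod_(i < t) gs i = map_mpoly iota (\prod_(i < t) fs i).
  by rewrite rmorph_prod.
have gs_multiaffine i : multiaffine (gs i).
  exact/multiaffine_map/(multiaffine_factor irr mf).
have gs_lead i : coefv (ys i) 1 (gs i) != 0.
  rewrite coefv_map map_mpoly_eq0; apply: contra_neq (dy i) => c0.
  have mfi := multiaffine_factor irr mf i.
  rewrite (degv1E (mfi (ys i))) c0 mulr0 addr0; exact: degv_coefv_same.
have gs_other i k : k != i -> degv (ys k) (gs i) = 0%N.
  move=> ki; apply/eqP; rewrite -leqn0; apply: leq_trans (degv_map_le _ _ _) _.
  by rewrite (degv_other_factor irr mf (dy k)) // eq_sym.
have F_multiaffine : multiaffine (\prod_(i < t) gs i).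
  by rewrite FE; apply: multiaffine_map.
have F_neq0 : \prod_(i < t) gs i != 0.
  by rewrite FE map_mpoly_eq0 irreducible_prod_neq0.
have F_elim : eliminable [set ys i | i : 'I_t]%SET (\prod_(i < t) gs i).
  by rewrite FE; apply: eliminable_map; apply: irreducible_prod_eliminable.
have [ev [ev_gs ev_free]] := generic_zero gs_multiaffine gs_lead gs_other.
have proper : ~ ideal_gen (range gs) 1.
  move=> one; have : ev 1 = 0.
    move: one; apply: (@ideal_gen_min _ (range gs) [set a | ev a = 0]).
      split=> [|a b /= a0 b0|a b /= b0]; first exact: rmorph0.
        by rewrite rmorphD a0 b0 addr0.
      by rewrite rmorphM b0 mulr0.
    by move=> _ [i _ <-]; apply: ev_gs.
  by rewrite rmorph1 => /eqP; rewrite oner_eq0.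
have [pi [pi_surj pi_ker]] := tensor_presentation proper.
exact: (presented_F_rational charL gs_multiaffine gs_lead gs_other F_multiaffine
          F_neq0 F_elim pi_surj pi_ker ev_gs ev_free).
Qed.
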